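(* Let $G$ be a $\rho$-uniform stochastic graph which is irreducible and positively recurrent, and let $\phi\in\mathcal{H}om(G,I)$ be a homomorphism of degree $d=d(\phi)$. Then there exists a commutative diagram of homomorphisms $$\begin{array}{ccc}\bar H&\xrightarrow{\ \bar\psi\ }&G\\ {\scriptstyle\bar\phi}\downarrow& &\downarrow{\scriptstyle\phi}\\ H&\xrightarrow{\ \psi\ }&I\end{array}$$ (i.e. $\phi\circ\bar\psi=\psi\circ\bar\phi$) where the graph $\bar H=\bar H_a$ is a graph skew product over $H$ generated by a function $a:H\to\mathcal A_d$, the homomorphism $\bar\phi$ coincides with the natural projection $\pi_H:\bar H_a\to H$, and both homomorphisms $\bar\psi\in\mathcal{H}om(\bar H,G)$ and $\psi\in\mathcal{H}om(H,I)$ are of degree $1$. In particular, $(\bar\phi,\psi)\in\mathcal{E}xt^d(I,\rho)$.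
   Context: **Stochastic graphs and Markov shifts.** A stochastic graph $(G,p)$ is a directed graph with countable (finite or infinite) edge set $G$, vertex set $G^{(0)}$, start and terminal maps $s,t:G\to G^{(0)}$, such that $G_u=\{g:s(g)=u\}$ and ${}_vG=\{g:t(g)=v\}$ are nonempty for all vertices, with weights $p(g)>0$ satisfying $\sum_{g\in G_u}p(g)=1$ for every $u$. Standing assumption (positive recurrence): there are stationary probabilities $p^{(0)}(u)>0$ with $\sum_u p^{(0)}(u)=1$ and $\sum_{g\in {}_vG}p(g)p^{(0)}(s(g))=p^{(0)}(v)$ for all $v$. $G$ is irreducible if for all vertices $u,v$ there are $g_1,\dots,g_n\in G$ with $s(g_k)=t(g_{k+1})$, $s(g_n)=u$, $t(g_1)=v$. Let $X_G=\{(x_n)_{n\ge1}\in G^{\mathbb N}: s(x_n)=t(x_{n+1})\ \forall n\}$, with $m_G(x_1=g_1,\dots,x_n=g_n)=p(g_1)\cdots p(g_n)p^{(0)}(s(g_n))$ on cylinders. **Homomorphisms.** A homomorphism $\phi:G\to H$ is a map of edges for which there is $\phi^{(0)}:G^{(0)}\to H^{(0)}$ with $s(\phi(g))=\phi^{(0)}(s(g))$, $t(\phi(g))=\phi^{(0)}(t(g))$, $\phi^{(0)}$ surjective, $\phi|_{G_u}:G_u\to H_{\phi^{(0)}(u)}$ bijective for every $u$, and $p(\phi(g))=p(g)$; $\mathcal{H}om(G,H)$ is the set of homomorphisms. The factor map is $\Phi_\phi:X_G\to X_H$, $(x_n)\mapsto(\phi(x_n))$. For $G$ irreducible, the degree $d(\phi)$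 is the integer $d$ such that for a.e. $x\in X_H$ the fibre $\Phi_\phi^{-1}(x)$ consists of $d$ points (mod null sets: the conditional measures of $m_G$ on fibres are uniform on $d$ points). **Bernoulli graph.** $I$ finite or countable, $\rho(i)>0$, $\sum_{i\in I}\rho(i)=1$; $(I,\rho)$ is the stochastic graph with edge set $I$, weights $\rho(i)$ and a single vertex. $G$ is $\rho$-uniform if $\mathcal{H}om(G,I)\ne\emptyset$. **Graph skew products and extensions.** For $d\in\mathbb N$, $Y_d=\{1,\dots,d\}$ and $\mathcal A_d$ is the group of all permutations of $Y_d$. Given $a:H\to\mathcal A_d$, the graph skew product $\bar H_a$ has edges $H\times Y_d$, vertices $H^{(0)}\times Y_d$, $s(h,y)=(s(h),y)$, $t(h,y)=(t(h),a(h)y)$, $p(h,y)=p(h)$, $p^{(0)}(u,y)=p^{(0)}(u)/d$; $\pi_H:\bar H_a\to H$, $(h,y)\mapsto h$. $\mathcal{E}xt^d(I,\rho)$ is the set of all pairs $(\pi,\psi)$, $\bar H\xrightarrow{\pi}H\xrightarrow{\psi}I$, where $\psi$ is a homomorphism of degree 1, $\bar H=\bar H_a$ is a graph skew product over $H$ generated by some $a:H\to\mathcal A_d$ with natural projection $\pi$, and $\bar H$ is irreducible. *)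

(* Defs.v *)
From HB Require Import structures.
From mathcomp Require Import all_boot all_order all_algebra all_fingroup.
From mathcomp Require Import all_classical all_reals all_analysis.

Set Implicit Arguments.
Unset Strict Implicit.
Unset Printing Implicit Defensive.

Import Order.TTheory GRing.Theory Num.Theory.

Local Open Scope classical_set_scope.
Local Open Scope ring_scope.

Lemma esumZl (R : realType) (T : choiceType) (S : set T) (a : T -> \bar R)
    (c : R) : 0 <= c -> (forall i, (0 <= a i)%E) ->
  (\esum_(i in S) (c%:E * a i) = c%:E * \esum_(i in S) a i)%E.
Proof.
move=> c0 a0; rewrite /esum -ereal_supZl //; last first.
  by apply/set0P; exists (\sum_(x \in set0) a x)%E;
    exists set0; [exact: fsets_set0|].
rewrite image_comp; congr ereal_sup; apply: eq_imagel => A _ /=.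
by rewrite ge0_mule_fsumr.
Qed.

(* Positive recurrence is a standing assumption, so the stationary
   probabilities [prob0] are part of the structure (for an irreducible graph
   they are determined by the rest).  Sums over the countable sets of edges and
   vertices are unordered sums in \bar R. *)
Record stochGraph (R : realType) := StochGraph {
  edge :> countType;
  vertex : countType;
  src : edge -> vertex;
  tgt : edge -> vertex;
  prob : edge -> R;
  prob0 : vertex -> R;
  src_surj : forall u, exists g, src g = u;
  tgt_surj : forall v, exists g, tgt g = v;
  prob_gt0 : forall g, 0 < prob g;
  prob_sum : forall u, (\esum_(g in [set g | src g = u]) (prob g)%:E = 1)%E;
  prob0_gt0 : forall u, 0 < prob0 u;
  prob0_sum : (\esum_(u in [set: vertex]) (prob0 u)%:E = 1)%E;
  prob0_stationary : forall v,
    (\esum_(g in [set g | tgt g = v]) (prob g * prob0 (src g))%:E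
       = (prob0 v)%:E)%E }.

Definition irreducible_graph (R : realType) (G : stochGraph R) : Prop :=
  forall u v : vertex G, exists (n : nat) (g : nat -> G),
    [/\ forall k, (k < n)%N -> src (g k) = tgt (g k.+1),
        src (g n) = u & tgt (g 0%N) = v].

(* X_G; sequences are indexed from 0. *)
Record markov_shift (R : realType) (G : stochGraph R) := MarkovShift {
  shift_seq :> nat -> G;
  shiftP : forall n, src (shift_seq n) = tgt (shift_seq n.+1) }.

Section ShiftSpace.
Variables (R : realType) (G : stochGraph R).

Lemma shift_inhabited : exists _ : markov_shift G, True.
Proof.
have [u _] : exists u : vertex G, True.
  apply: contrapT => noV; have := prob0_sum G.
  rewrite esum1 => [/esym/eqP|u]; first by rewrite onee_eq0.
  by case: noV; exists u.
have [g _] := src_surj u.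
have /choice[f fP] : forall e : G, exists e' : G, tgt e' = src e.
  by move=> e; exact: tgt_surj.
have xP n : src (iter n f g) = tgt (iter n.+1 f g) by rewrite /= fP.
by exists (MarkovShift xP).
Qed.

HB.instance Definition _ := gen_eqMixin (markov_shift G).
HB.instance Definition _ := gen_choiceMixin (markov_shift G).
HB.instance Definition _ := isPointed.Build (markov_shift G)
  (projT1 (cid shift_inhabited)).

Definition cylinder (n : nat) (g : nat -> G) : set (markov_shift G) :=
  [set x | forall k, (k <= n)%N -> x k = g k].

Definition cylinders : set (set (markov_shift G)) :=
  [set C | exists n g, C = cylinder n g].

Definition shift_space := g_sigma_algebraType cylinders.

HB.instance Definition _ := Measurable.on shift_space.

(* [m] is the measure m_G.  The condition determines [m], because cylinders of
   non-admissible words are empty. *)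
Definition is_markov_measure (m : probability shift_space R) : Prop :=
  forall (n : nat) (g : nat -> G),
    (forall k, (k < n)%N -> src (g k) = tgt (g k.+1)) ->
    m (cylinder n g) = (\prod_(k < n.+1) prob (g k) * prob0 (src (g n)))%:E.

End ShiftSpace.

Definition is_graph_hom (R : realType) (G H : stochGraph R) (phi : G -> H) : Prop :=
  exists phi0 : vertex G -> vertex H,
    [/\ forall g, src (phi g) = phi0 (src g) /\ tgt (phi g) = phi0 (tgt g),
        forall v, exists u, phi0 u = v,
        forall u, set_bij [set g | src g = u] [set h | src h = phi0 u] phi &
        forall g, prob (phi g) = prob g].

Record graph_hom (R : realType) (G H : stochGraph R) := GraphHom {
  graph_hom_fun :> G -> H;
  graph_homP : is_graph_hom graph_hom_fun }.

Section FactorMap.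
Variables (R : realType) (G H : stochGraph R) (phi : graph_hom G H).

Lemma factor_map_subproof (x : markov_shift G) n :
  src (phi (x n)) = tgt (phi (x n.+1)).
Proof. by have [phi0 [st _ _ _]] := graph_homP phi; rewrite (st _).1 (st _).2 shiftP. Qed.

Definition factor_map (x : shift_space G) : shift_space H :=
  MarkovShift (factor_map_subproof x).

(* [has_degree d] is the property d(phi) = d: the kernel [kappa] is the
   disintegration of m_G over m_H along the factor map, and almost all of the
   conditional measures are uniform on [d] points of the fibre.  This
   forces [0 < d], since [kappa x] has mass 1. *)
Definition has_degree (d : nat) : Prop :=
  exists (mG : probability (shift_space G) R)
         (mH : probability (shift_space H) R)
         (kappa : R.-pker (shift_space H) ~> (shift_space G)),
    [/\ is_markov_measure mG,
        is_markov_measure mH,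
        forall A, measurable A -> mG A = (\int[mH]_x kappa x A)%E &
        {ae mH, forall x, exists y : 'I_d -> shift_space G,
          [/\ injective y,
              forall i, factor_map (y i) = x &
              forall A, measurable A ->
                kappa x A = ((d%:R^-1)%:E * \sum_(i < d) \d_(y i) A)%E]}].

End FactorMap.

Section Bernoulli.
Variables (R : realType) (I : countType) (rho : I -> R).
Hypothesis rho_gt0 : forall i, 0 < rho i.
Hypothesis rho_sum : (\esum_(i in [set: I]) (rho i)%:E = 1)%E.

Let bsrc (i : I) : unit := tt.

Let bprob0 (u : unit) : R := 1.

Let bset u : [set i | bsrc i = u] = [set: I].
Proof. by apply/seteqP; split=> // i _; case: u. Qed.

Let bsurj u : exists i, bsrc i = u.
Proof.
apply: contrapT => noI; have := rho_sum.
rewrite esum1 => [/esym/eqP|i _]; first by rewrite onee_eq0.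
by case: noI; exists i; case: u.
Qed.

Let bprob_sum u : (\esum_(i in [set i | bsrc i = u]) (rho i)%:E = 1)%E.
Proof. by rewrite bset. Qed.

Let bprob0_gt0 u : 0 < bprob0 u. Proof. exact: ltr01. Qed.

Let bprob0_sum : (\esum_(u in [set: unit]) (bprob0 u)%:E = 1)%E.
Proof.
rewrite (_ : [set: unit] = [set tt]); last by apply/seteqP; split=> // -[].
by rewrite esum_set1 // lee_fin ler01.
Qed.

Let bstationary v :
  (\esum_(i in [set i | bsrc i = v]) (rho i * bprob0 (bsrc i))%:E
    = (bprob0 v)%:E)%E.
Proof. by rewrite bset -rho_sum; apply: eq_esum => i _; rewrite mulr1. Qed.

Definition bernoulli_graph : stochGraph R :=
  StochGraph bsurj bsurj rho_gt0 bprob_sum bprob0_gt0 bprob0_sum bstationary.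

Definition rho_uniform (G : stochGraph R) : Prop :=
  exists phi : G -> bernoulli_graph, is_graph_hom phi.

End Bernoulli.

Section SkewProduct.
Variables (R : realType) (H : stochGraph R) (d : nat).
Hypothesis d_gt0 : (0 < d)%N.
Variable a : H -> {perm 'I_d}.

Let sedge : countType := (edge H * 'I_d)%type.
Let svertex : countType := (vertex H * 'I_d)%type.
Let ssrc (e : sedge) : svertex := (src e.1, e.2).
Let stgt (e : sedge) : svertex := (tgt e.1, a e.1 e.2).
Let sprob (e : sedge) : R := prob e.1.
Let sprob0 (u : svertex) : R := prob0 u.1 / d%:R.

Let ssrc_surj u : exists e, ssrc e = u.
Proof. by case: u => u y; have [h <-] := src_surj u; exists (h, y). Qed.

Let stgt_surj v : exists e, stgt e = v.
Proof.
case: v => v y; have [h <-] := tgt_surj v.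
by exists (h, (a h)^-1%g y); rewrite /stgt /= permKV.
Qed.

Let sprob_gt0 e : 0 < sprob e. Proof. exact: prob_gt0. Qed.

Let sprob_sum u : (\esum_(e in [set e | ssrc e = u]) (sprob e)%:E = 1)%E.
Proof.
case: u => u y; rewrite -(prob_sum u) (_ : [set e | _] =
  (fun h : H => (h, y)) @` [set h | src h = u]).
  by rewrite esum_image // => h1 h2 _ _ [].
apply/seteqP; split=> [[h z] /= [<- <-]|_ [h /= <- <-] //].
by exists h.
Qed.

Let sprob0_gt0 u : 0 < sprob0 u.
Proof. by rewrite divr_gt0 ?prob0_gt0 // ltr0n. Qed.

Let esum_fiber (c : R) : 0 <= c ->
  (\esum_(y in [set: 'I_d]) (c / d%:R)%:E = c%:E)%E.
Proof.
move=> c0; rewrite esum_fset; last 2 first.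
- exact: finite_finset.
- by move=> i _; rewrite lee_fin divr_ge0.
rewrite (_ : [set: 'I_d] = [set` index_enum 'I_d]); last first.
  by apply/seteqP; split=> i //= _; rewrite mem_index_enum.
rewrite -fsbig_seq ?index_enum_uniq // sumEFin big_const_ord iter_addr_0.
by rewrite -[(_ / _) *+ d]mulr_natr divfK // pnatr_eq0 -lt0n.
Qed.

Let sprob0_sum : (\esum_(u in [set: svertex]) (sprob0 u)%:E = 1)%E.
Proof.
rewrite -(prob0_sum H).
transitivity (\esum_(u in [set: vertex H])
  \esum_(y in [set: 'I_d]) (prob0 u / d%:R)%:E)%E; last first.
  by apply: eq_esum => u _; rewrite esum_fiber // ltW // prob0_gt0.
rewrite esum_esum => [|u y _ _]; last first.
  by rewrite lee_fin divr_ge0 // ltW // prob0_gt0.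
by congr esum; apply/seteqP; split.
Qed.

Let sstationary v :
  (\esum_(e in [set e | stgt e = v]) (sprob e * sprob0 (ssrc e))%:E
    = (sprob0 v)%:E)%E.
Proof.
case: v => v y; rewrite (_ : [set e | _] =
  (fun h : H => (h, (a h)^-1%g y)) @` [set h | tgt h = v]); last first.
  apply/seteqP; split=> [[h z] /= [<- <-]|_ [h /= <- <-]].
    by exists h => //; rewrite permK.
  by rewrite /stgt /= permKV.
rewrite esum_image => [|h1 h2 _ _ [] //].
transitivity ((d%:R^-1)%:E *
    \esum_(h in [set h | tgt h = v]) (prob h * prob0 (src h))%:E)%E.
  rewrite -esumZl ?invr_ge0 // => [|h]; last first.
    by rewrite lee_fin mulr_ge0 // ltW // ?prob_gt0 // prob0_gt0.
  by apply: eq_esum => h _; rewrite -EFinM /sprob /sprob0 mulrA mulrC.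
by rewrite prob0_stationary -EFinM mulrC.
Qed.

Definition skew_graph : stochGraph R :=
  StochGraph ssrc_surj stgt_surj sprob_gt0 sprob_sum sprob0_gt0 sprob0_sum
    sstationary.

Lemma skew_proj_subproof : @is_graph_hom R skew_graph H fst.
Proof.
exists fst; split=> // [v|[u y]].
  by exists (v, Ordinal d_gt0).
split=> [[h z] /= [<- _] //|[h z] [h' z'] /= |h /= <-].
  by rewrite !inE /= => -[_ ->] [_ ->] ->.
by exists (h, y).
Qed.

Definition skew_proj : graph_hom skew_graph H := GraphHom skew_proj_subproof.

End SkewProduct.

(* [Ext d_gt0 pi psi] states that (pi, psi) belongs to Ext^d(I, rho), for [K]
   the Bernoulli graph (I, rho). *)
Inductive Ext (R : realType) (K : stochGraph R) (d : nat) (d_gt0 : (0 < d)%N) :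
    forall Hbar H : stochGraph R, graph_hom Hbar H -> graph_hom H K -> Prop :=
  Ext_intro (H : stochGraph R) (psi : graph_hom H K) (a : H -> {perm 'I_d}) :
    has_degree psi 1 -> irreducible_graph (skew_graph d_gt0 a) ->
    Ext d_gt0 (skew_proj d_gt0 a) psi.

(* Main.v *)
(* Since each map phi : G_u -> I is bijective, a letter i acts on the vertices
   of G, and a point of X_G over a label sequence x is a sequence of vertices
   (u_n) with u_n = x_n u_(n+1).  The conditional law of u_n given the labels is
   carried by d points of the fibre; these can only merge when n decreases, so
   they are at distinct vertices for large n, and by stationarity for every n.
   Hence u_n is conditionally uniform on a d-subset S_n of vertices, and S_n is
   a function of (x_n, x_(n+1), ...) with S_n = x_n S_(n+1).  The vertices of H
   are the d-subsets that S_n charges; an edge is a pair (S, i).  Numbering each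
   d-subset turns the action of i on S into a permutation a(S, i), and
   psibar sends ((S, i), y) to the edge labelled i that starts at the y-th
   element of S.  Both psi and psibar have degree 1 because the sequence (S_n)
   is a function of x, and the skew product is irreducible because its shift is
   then a measurable copy of X_G, which is ergodic. *)
Require Import Defs.
From HB Require Import structures.
From mathcomp Require Import all_boot all_order all_algebra all_fingroup.
From mathcomp Require Import all_classical all_reals all_analysis.
From mathcomp Require Import measurable_realfun lra.

Set Implicit Arguments.
Unset Strict Implicit.
Unset Printing Implicit Defensive.

Import Order.TTheory GRing.Theory Num.Theory.

Local Open Scope classical_set_scope.
Local Open Scope ring_scope.

(** * Almost sure events and countably valued maps *)

Section CountableValued.
Context {d : measure_display} {T : measurableType d}.

(** Measurability for the discrete sigma-algebra on [C]. As [C] is countable, singletons suffice,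
    and [C] needs no measurable structure of its own. *)
Definition cmeasurable (C : countType) (f : T -> C) :=
  forall c, measurable (f @^-1` [set c]).

Lemma cmeasurable_preimage (C : countType) (f : T -> C) (D : set C) :
  cmeasurable f -> measurable (f @^-1` D).
Proof.
move=> mf; rewrite (_ : _ @^-1` _ = \bigcup_c [set x | D c /\ f x = c]).
  apply: countable_bigcupT_measurable => [|c]; first exact: countableP.
  have [Dc|nDc] := pselect (D c).
    by rewrite (_ : [set _ | _] = f @^-1` [set c]) //; apply/seteqP; split=> x // -[].
  by rewrite (_ : [set _ | _] = set0) //; apply/seteqP; split=> x // -[].
by apply/seteqP; split=> [x Dx|x [c _ [Dc fx]]] /=; [exists (f x)|rewrite fx].
Qed.

Lemma cmeasurable_comp (C C' : countType) (f : T -> C) (g : C -> C') :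
  cmeasurable f -> cmeasurable (g \o f).
Proof.
by move=> mf c; exact: (cmeasurable_preimage (g @^-1` [set c]) mf).
Qed.

Lemma cmeasurable_pair (C C' : countType) (f : T -> C) (g : T -> C') :
  cmeasurable f -> cmeasurable g -> cmeasurable (fun x => (f x, g x)).
Proof.
move=> mf mg [c c']; rewrite (_ : _ @^-1` _ =
  f @^-1` [set c] `&` g @^-1` [set c']); first exact: measurableI.
by apply/seteqP; split=> x /=; [move=> [<- <-]|move=> [-> ->]].
Qed.

Lemma measurable_forall_nat (P : nat -> set T) :
  (forall n, measurable (P n)) -> measurable [set x | forall n, P n x].
Proof.
move=> mP; rewrite (_ : [set _ | _] = \bigcap_n P n).
  exact: bigcapT_measurable.
by apply/seteqP; split=> [x Px n _|x Px n]; exact: Px.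
Qed.

Lemma measurable_forall (C : countType) (P : C -> set T) :
  (forall c, measurable (P c)) -> measurable [set x | forall c, P c x].
Proof.
move=> mP; rewrite (_ : [set _ | _] = ~` \bigcup_c ~` P c); last first.
  apply/seteqP; split=> [x Px [c _]|x nx c]; first by apply.
  by apply: contrapT => nP; apply: nx; exists c.
apply: measurableC; apply: countable_bigcupT_measurable => [|c].
  exact: countableP.
exact: measurableC.
Qed.

Lemma measurable_exists (C : countType) (P : C -> set T) :
  (forall c, measurable (P c)) -> measurable [set x | exists c, P c x].
Proof.
move=> mP; rewrite (_ : [set _ | _] = \bigcup_c P c); last first.
  by apply/seteqP; split=> x [c]; exists c.
by apply: countable_bigcupT_measurable => //; exact: countableP.
Qed.

Lemma measurable_imply (b : Prop) (P : set T) :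
  measurable P -> measurable [set x | b -> P x].
Proof.
have [bT|bF] := pselect b => mP.
  rewrite (_ : [set _ | _] = P) //.
  by apply/seteqP; split=> [x /(_ bT)|x Px _].
suff -> : [set x | b -> P x] = setT by exact: measurableT.
by apply/seteqP; split=> // x _ /bF.
Qed.

(** Countable additivity over the fibres of [f], transported by [pickle] to a series over the
    naturals. *)
Lemma measure_cmeasurable (R : realType) (m : {measure set T -> \bar R})
    (C : countType) (f : T -> C) (A : set T) (D : set C) :
  cmeasurable f -> measurable A ->
  m (A `&` f @^-1` D) = (\esum_(c in D) m (A `&` f @^-1` [set c]))%E.
Proof.
move=> mf mA.
pose F n := A `&` [set x | pickle (f x) = n].
have FE c : F (pickle c) = A `&` f @^-1` [set c].
  by congr (_ `&` _); apply/seteqP; split=> x /= => [/(pcan_inj pickleK)|->].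
transitivity (m (\bigcup_(n in pickle @` D) F n)).
  congr (m _); apply/seteqP; split=> [x [Ax Dx]|x [_ [c Dc <-]]].
    by exists (pickle (f x)) => //; exists (f x).
  by rewrite FE => -[Ax fx]; split=> //=; rewrite fx.
rewrite measure_bigcup; last 2 first.
- by move=> _ [c _ <-]; rewrite FE; exact: measurableI.
- by move=> i j _ _ [x [[_ /= <-] [_ /= <-]]].
rewrite nneseries_esum // set_mem_set esum_image; last first.
  by move=> c c' _ _ /(pcan_inj pickleK).
by apply: eq_esum => c _; rewrite FE.
Qed.

End CountableValued.

Section AlmostEverywhere.
Context {d : measure_display} {T : measurableType d} {R : realType}.
Variable m : {measure set T -> \bar R}.

Lemma ae_le_measure (A B : set T) : measurable A -> measurable B ->
  {ae m, forall x, A x -> B x} -> (m A <= m B)%E.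
Proof.
move=> mA mB [N [mN N0 sN]].
rewrite (@le_trans _ _ (m (B `|` N))) //.
  apply: le_measure; rewrite ?inE //; first exact: measurableU.
  move=> x Ax; have [Bx|nBx] := pselect (B x); first by left.
  by right; apply: sN => /= /(_ Ax).
apply: (le_trans (measureU2 _ mB mN)).
by rewrite [X in (_ + X)%E](_ : _ = 0%E) ?adde0.
Qed.

Lemma ae_eq_measure (A B : set T) : measurable A -> measurable B ->
  {ae m, forall x, A x <-> B x} -> m A = m B.
Proof.
move=> mA mB AB; apply/eqP; rewrite eq_le.
by apply/andP; split; apply: ae_le_measure => //; apply: filterS AB => x [].
Qed.

(** Produces actual points from almost sure statements. This is how facts known almost surely become
    facts about every state of positive mass. *)
Lemma ae_exists (A P : set T) : measurable A -> m A != 0%E ->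
  {ae m, forall x, P x} -> exists2 x, A x & P x.
Proof.
move=> mA mA0 aeP; apply: contrapT => nex; move/eqP: mA0; apply.
rewrite -(measure0 m); apply: ae_eq_measure => //.
by apply: filterS aeP => x Px; split=> // Ax; case: nex; exists x.
Qed.

Lemma ae_forall (C : countType) (P : C -> set T) :
  (forall c, {ae m, forall x, P c x}) -> {ae m, forall x, forall c, P c x}.
Proof.
move=> aeP.
have : {ae m, forall x, forall n, if unpickle n is Some c then P c x else True}.
  apply: ae_foralln => n; case: (unpickle n) => [c|]; first exact: aeP.
  exact: aeW.
by apply: filterS => x Px c; have := Px (pickle c); rewrite pickleK.
Qed.

End AlmostEverywhere.

Lemma ae_comp {d d'} {T : measurableType d} {T' : measurableType d'}
    {R : realType} (m : {measure set T -> \bar R})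
    (m' : {measure set T' -> \bar R}) (f : T -> T') (P : T' -> Prop) :
  measurable_fun setT f ->
  (forall N, measurable N -> m' N = 0%E -> m (f @^-1` N) = 0%E) ->
  {ae m', forall y, P y} -> {ae m, forall x, P (f x)}.
Proof.
move=> mf fnull [N [mN N0 sN]]; exists (f @^-1` N); split.
- by rewrite -[X in measurable X]setTI; exact: mf.
- exact: fnull.
- by move=> x nP; apply: sN.
Qed.

(** * Shift spaces *)

Section ShiftSpaceTheory.
Variables (R : realType) (G : stochGraph R).

Definition admissible n (g : nat -> G) :=
  forall k, (k < n)%N -> src (g k) = tgt (g k.+1).

Lemma markov_shift_ext (x y : markov_shift G) : (forall n, x n = y n) -> x = y.
Proof.
case: x y => [x xP] [y yP] /= /funext xy; rewrite xy in xP *.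
by congr MarkovShift; exact: Prop_irrelevance.
Qed.

Lemma measurable_cylinder n g : measurable (cylinder n g : set (shift_space G)).
Proof. by apply: sub_sigma_algebra; exists n, g. Qed.

Lemma cmeasurable_coord n : cmeasurable (fun z : shift_space G => z n : G).
Proof.
(* Only cylinders are generators, so the event is cut into countably many of them, one for each
   finite word [w] with letter [e] at position [n]. *)
move=> e; rewrite (_ : _ @^-1` _ =
    [set z | exists w : seq G, nth e w n = e /\ cylinder n (nth e w) z]).
  apply: (measurable_exists (P := fun w : seq G =>
    [set z : shift_space G | nth e w n = e /\ cylinder n (nth e w) z])) => w.
  have [we|we] := pselect (nth e w n = e).
    rewrite (_ : [set _ | _] = cylinder n (nth e w)).
      exact: measurable_cylinder.
    by apply/seteqP; split=> z // -[].
  by rewrite (_ : [set _ | _] = set0) //; apply/seteqP; split=> z // -[].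
apply/seteqP; split=> [z ze|z [w [we zw]]] /=; last by rewrite zw.
exists (mkseq z n.+1); rewrite nth_mkseq //; split=> // k kn.
by rewrite nth_mkseq.
Qed.

Lemma measurable_into_shift d (T : measurableType d) (f : T -> shift_space G) :
  (forall n, cmeasurable (fun t => f t n : G)) -> measurable_fun setT f.
Proof.
move=> mf; apply: (@measurability _ _ T (shift_space G) setT f (@cylinders R G) erefl).
move=> _ [_ [n [g ->]] <-]; rewrite setTI.
by apply: measurable_forall_nat => k; apply: measurable_imply; exact: (mf k).
Qed.

Lemma cylinder_not_admissible n g : ~ admissible n g ->
  cylinder n g = set0 :> set (shift_space G).
Proof.
move=> nadm; apply/seteqP; split=> // z zg; apply: nadm => k kn.
by rewrite -!zg // 1?ltnW // shiftP.
Qed.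

(** Cylinders of incompatible words are disjoint, so the empty set is adjoined to get a pi-system
    that generates the same sigma-algebra. *)
Let cylinders0 : set (set (shift_space G)) :=
  [set C | C = set0 \/ cylinders C].

Let cylinders0_setI : setI_closed cylinders0.
Proof.
have key (n m : nat) (g h : nat -> G) : (n <= m)%N ->
    cylinders0 (cylinder n g `&` cylinder m h).
  move=> nm; have [gh|gh] := pselect (forall k, (k <= n)%N -> g k = h k).
    right; exists m, h; apply/seteqP; split=> [z []//|z zh]; split=> // k kn.
    by rewrite gh // zh // (leq_trans kn).
  left; apply/seteqP; split=> // z [zg zh]; apply: gh => k kn.
  by rewrite -zg // zh // (leq_trans kn).
move=> _ _ [->|[n [g ->]]] [->|[m [h ->]]].
- by left; rewrite setI0.
- by left; rewrite set0I.
- by left; rewrite setI0.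
- by have [/key//|/ltnW/key] := leqP n m; rewrite setIC; apply.
Qed.

Let cylinders0_generate : @measurable _ (shift_space G) = <<s cylinders0 >>.
Proof.
apply/seteqP; split; apply: smallest_sub.
- exact: smallest_sigma_algebra.
- by move=> C cC; apply: sub_sigma_algebra; right.
- exact: smallest_sigma_algebra.
- move=> C [->|cC]; last exact: sub_sigma_algebra.
  exact: sigma_algebra0.
Qed.

Lemma eq_cylinder_measure (m1 m2 : {measure set (shift_space G) -> \bar R}) :
  (m1 setT < +oo)%E ->
  (forall n g, admissible n g -> m1 (cylinder n g) = m2 (cylinder n g)) ->
  forall A, measurable A -> m1 A = m2 A.
Proof.
move=> m1oo m12.
have mC A : cylinders0 A -> measurable A.
  by rewrite cylinders0_generate; exact: sub_sigma_algebra.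
(* Uniqueness of measures asks for a countable cover by sets of finite measure; the one-letter
   cylinders form one. *)
pose F k := if unpickle k is Some e then cylinder 0 (fun _ : nat => e : G)
  else set0.
have cF k : cylinders0 (F k).
  by rewrite /F; case: unpickle => [e|]; [right; exists 0%N, (fun=> e)|left].
apply: (measure_unique cylinders0 F) => //.
- apply/seteqP; split=> // z _; exists (pickle (z 0%N : G)) => //.
  by rewrite /F pickleK => k; rewrite leqn0 => /eqP ->.
- move=> A [->|[n [g ->]]]; first by rewrite !measure0.
  have [adm|nadm] := pselect (admissible n g); first exact: m12.
  by rewrite cylinder_not_admissible // !measure0.
- move=> k; apply: le_lt_trans m1oo; apply: le_measure; rewrite ?inE //.
  exact: mC.
Qed.

Lemma shiftmap_subproof (x : markov_shift G) n : src (x n.+1) = tgt (x n.+2).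
Proof. exact: shiftP. Qed.

Definition shiftmap (x : shift_space G) : shift_space G :=
  MarkovShift (shiftmap_subproof x).

Lemma measurable_shiftmap : measurable_fun setT shiftmap.
Proof.
by apply: measurable_into_shift => n; exact: (cmeasurable_coord n.+1).
Qed.

Lemma iter_shiftmapE n (x : shift_space G) k : iter n shiftmap x k = x (n + k)%N.
Proof. by elim: n k => [|n IHn] k //=; rewrite IHn addnS. Qed.

Lemma measurable_iter_shiftmap n : measurable_fun setT (iter n shiftmap).
Proof.
apply: measurable_into_shift => k.
rewrite (_ : (fun t => _) = fun t : shift_space G => t (n + k)%N).
  exact: cmeasurable_coord.
by apply/funext => t; rewrite iter_shiftmapE.
Qed.

Definition head_vertex (z : shift_space G) : vertex G := tgt (z 0%N).

Lemma cmeasurable_head_vertex : cmeasurable head_vertex.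
Proof. exact: cmeasurable_comp (cmeasurable_coord 0). Qed.

(** The edges fit together only almost surely. Outside the measurable set [good] where they do, [f]
    takes the fixed value [point], which keeps it measurable. *)
Lemma measurable_lift d (T : measurableType d) (m : {measure set T -> \bar R})
    (e : nat -> T -> G) :
  (forall n, cmeasurable (e n)) ->
  (forall n, {ae m, forall t, src (e n t) = tgt (e n.+1 t)}) ->
  exists2 f : T -> shift_space G, measurable_fun setT f &
    {ae m, forall t n, f t n = e n t}.
Proof.
move=> me ae_e.
pose good := [set t | forall n, src (e n t) = tgt (e n.+1 t)].
have mgood : measurable good.
  apply: measurable_forall_nat => n.
  exact: (cmeasurable_preimage [set p : G * G | src p.1 = tgt p.2]
    (cmeasurable_pair (me n) (me n.+1))).
pose f t : shift_space G :=
  if pselect (good t) is left p then MarkovShift p else point.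
exists f; last first.
  apply: filterS (ae_foralln ae_e) => t gt n.
  by rewrite /f; case: pselect.
apply: measurable_into_shift => n c.
rewrite (_ : _ @^-1` _ = (good `&` e n @^-1` [set c]) `|`
  (~` good `&` [set t | (point : shift_space G) n = c])).
  apply: measurableU; first exact: measurableI (me n c).
  apply: measurableI; first exact: measurableC.
  have [pc|pc] := pselect ((point : shift_space G) n = c).
    suff -> : [set t : T | (point : shift_space G) n = c] = setT.
      exact: measurableT.
    by apply/seteqP; split=> // t _ /=.
  suff -> : [set t : T | (point : shift_space G) n = c] = set0 by exact: measurable0.
  by apply/seteqP; split=> // t /pc.
apply/seteqP; split=> t /=; rewrite /f; case: pselect => gt //=.
- by left.
- by right.
- by case=> -[].
- by case=> -[].
Qed.

End ShiftSpaceTheory.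

(** * Markov measures and ergodicity *)

Lemma pushforward_measure d d' (T : measurableType d) (T' : measurableType d')
    (R : realType) (m : {measure set T -> \bar R}) (f : T -> T') :
  measurable_fun setT f ->
  exists m' : {measure set T' -> \bar R}, forall A, m' A = m (f @^-1` A).
Proof.
move=> mf.
by unshelve refine
  (ex_intro _ (pushforward m f : {measure set T' -> \bar R}) _).
Qed.

Lemma pushforward_probability d d' (T : measurableType d)
    (T' : measurableType d') (R : realType) (m : probability T R)
    (f : T -> T') :
  measurable_fun setT f ->
  exists m' : probability T' R, forall A, m' A = m (f @^-1` A).
Proof.
move=> mf.
pose f' : {mfun T >-> T'} := HB.pack f (isMeasurableFun.Build _ _ _ _ _ mf).
by exists (distribution m f').
Qed.

Lemma measurable_preimageT d d' (T : measurableType d) (T' : measurableType d')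
    (f : T -> T') (A : set T') :
  measurable_fun setT f -> measurable A -> measurable (f @^-1` A).
Proof. by move=> mf mA; rewrite -[X in measurable X]setTI; exact: mf. Qed.

Lemma cmeasurable_comp_measurable d d' (T : measurableType d)
    (T' : measurableType d') (C : countType) (f : T -> T') (g : T' -> C) :
  measurable_fun setT f -> cmeasurable g -> cmeasurable (g \o f).
Proof. by move=> mf mg c; exact: (measurable_preimageT mf (mg c)). Qed.


Section MarkovMeasureTheory.
Variables (R : realType) (G : stochGraph R).
Variables (m : probability (shift_space G) R).
Hypothesis mM : is_markov_measure m.

Let z0 (z : shift_space G) : G := z 0%N.
Let hv := @head_vertex _ G.
Let shift := @shiftmap _ G.

Let mz0 : cmeasurable z0. Proof. exact: cmeasurable_coord. Qed.
Let mhv : cmeasurable hv. Proof. exact: cmeasurable_head_vertex. Qed.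
Let msh D : measurable D -> measurable (shift @^-1` D).
Proof. by move=> mD; exact: measurable_preimageT (@measurable_shiftmap _ G) _. Qed.

(** Both sides are finite measures in [D], so they are compared on cylinders. There, putting [g] in
    front of an admissible word multiplies the mass by [prob g]; if [g] does not fit, both masses
    vanish. *)
Lemma markov_property (g : G) (D : set (shift_space G)) : measurable D ->
  m ((fun z : shift_space G => z 0%N) @^-1` [set g] `&` @shiftmap _ G @^-1` D) =
  ((prob g)%:E * m (D `&` @head_vertex _ G @^-1` [set src g]))%E.
Proof.
move=> mD.
have mA : measurable ((fun z : shift_space G => z 0%N) @^-1` [set g]).
  exact: (@cmeasurable_coord _ G 0%N g).
have mB : measurable (@head_vertex _ G @^-1` [set src g]).
  exact: (@cmeasurable_head_vertex _ G (src g)).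
have [m1 m1E] : exists m1 : {measure set (shift_space G) -> \bar R},
    forall X, m1 X = m ((fun z : shift_space G => z 0%N) @^-1` [set g] `&`
      @shiftmap _ G @^-1` X).
  have [m1 m1E] := pushforward_measure (mrestr m mA) (@measurable_shiftmap _ G).
  by exists m1 => X; rewrite m1E setIC.
have [m2 m2E] : exists m2 : {measure set (shift_space G) -> \bar R},
    forall X, m2 X =
      ((prob g)%:E * m (X `&` @head_vertex _ G @^-1` [set src g]))%E.
  by exists (mscale (NngNum (ltW (prob_gt0 g))) (mrestr m mB)).
rewrite -m1E -m2E; apply: eq_cylinder_measure => //.
  rewrite m1E preimage_setT setIT; apply: (@le_lt_trans _ _ 1%E); last exact: ltry.
  exact: probability_le1.
move=> n h hadm; rewrite m1E m2E.
have [gh|gh] := pselect (src g = tgt (h 0%N)); last first.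
  rewrite (_ : _ `&` _ = set0).
    rewrite (_ : cylinder n h `&` _ = set0) ?measure0 ?mule0 //.
    by apply/seteqP; split=> // z [zh zg]; apply: gh; rewrite -zg -zh.
  apply/seteqP; split=> // z [zg zh]; apply: gh.
  by rewrite -zg -(zh 0%N) // shiftP.
pose gh' k := if k is k'.+1 then h k' else g.
have gadm : admissible n.+1 gh' by case=> [|k] //= kn; exact: hadm.
rewrite (_ : _ `&` _ = cylinder n.+1 gh'); last first.
  apply/seteqP; split=> [z [zg zh] [|k] //= kn|z zgh]; first exact: zh.
  split; first exact: (zgh 0%N).
  by move=> k kn; exact: (zgh k.+1).
rewrite (_ : _ `&` _ = cylinder n h); last first.
  by apply/seteqP; split=> [z []//|z zh]; split=> //; rewrite /head_vertex /= zh.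
by rewrite !mM // big_ord_recl -EFinM mulrA.
Qed.

Lemma markov_measure_edge (g : G) :
  m (z0 @^-1` [set g]) = (prob g * prob0 (src g))%:E.
Proof.
rewrite (_ : _ @^-1` _ = cylinder 0 (fun=> g)); last first.
  apply/seteqP; split=> [z zg k|z]; first by rewrite leqn0 => /eqP ->.
  exact.
by rewrite mM // big_ord_recl big_ord0 mulr1.
Qed.

(** Split by the vertex [u] where the first edge starts, which is the head vertex of the shifted
    point. By [markov_property] the edges leaving [u] contribute the factors [prob g], whose sum is
    1. *)
Lemma shift_invariant D : measurable D -> m (shift @^-1` D) = m D.
Proof.
move=> mD.
have msrc : cmeasurable (@src R G \o z0) by exact: cmeasurable_comp.
rewrite -[in LHS](setIT (_ @^-1` _)) -[in LHS](preimage_setT (@src R G \o z0)).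
rewrite -[in RHS](setIT D) -[in RHS](preimage_setT hv).
rewrite !measure_cmeasurable //; last exact: msh.
apply: eq_esum => u _; rewrite comp_preimage.
rewrite measure_cmeasurable //; last exact: msh.
have mDu : measurable (D `&` hv @^-1` [set u]) by apply: measurableI => //; exact: mhv.
transitivity (\esum_(g in [set g : G | src g = u])
    ((fine (m (D `&` hv @^-1` [set u])))%:E * (prob g)%:E))%E.
  apply: eq_esum => g /= <-; rewrite fineK ?fin_num_measure // 1?muleC; last first.
    by apply: measurableI => //; exact: mhv.
  by rewrite setIC markov_property.
rewrite esumZl ?fine_ge0 // => [|g]; last by rewrite lee_fin ltW // prob_gt0.
by rewrite prob_sum mule1 fineK // fin_num_measure.
Qed.

Lemma iter_shift_invariant n D : measurable D ->
  m (iter n shift @^-1` D) = m D.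
Proof.
move=> mD; elim: n => // n IHn.
rewrite -IHn -[RHS]shift_invariant; last first.
  exact: (measurable_preimageT (@measurable_iter_shiftmap _ G n)).
by congr (m _); apply/funext => z; rewrite /preimage /= -iterSr.
Qed.

Lemma ae_iter_shift n (P : shift_space G -> Prop) :
  {ae m, forall z, P z} -> {ae m, forall z, P (iter n shift z)}.
Proof.
apply: ae_comp; first exact: measurable_iter_shiftmap.
by move=> N mN N0; rewrite -[RHS]N0; exact: iter_shift_invariant.
Qed.

End MarkovMeasureTheory.

Lemma irreducible_closed (R : realType) (G : stochGraph R)
    (E : set (vertex G)) (u v : vertex G) :
  irreducible_graph G -> (forall g : G, E (src g) -> E (tgt g)) -> E u -> E v.
Proof.
move=> Girr Ecl Eu; have [n [g [gadm gu <-]]] := Girr u v.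
(* The path is indexed backwards, with [g 0] as its last edge, so the induction descends from
   [n]. *)
suff H k : (k <= n)%N -> E (tgt (g (n - k)%N)) by rewrite -(subnn n); exact: H.
elim: k => [_|k IHk kn]; first by rewrite subn0; apply: Ecl; rewrite gu.
apply: Ecl; rewrite gadm; last by rewrite ltn_subrL /= (leq_trans _ kn).
by rewrite subnSK //; apply: IHk; exact: ltnW.
Qed.

(** * Zero-one law for invariant events of an irreducible Markov shift *)

Section Ergodicity.
Variables (R : realType) (G : stochGraph R).
Variables (m : probability (shift_space G) R).
Hypothesis mM : is_markov_measure m.
Hypothesis Girr : irreducible_graph G.

Let z0 (z : shift_space G) : G := z 0%N.
Let hv := @head_vertex _ G.
Let shift := @shiftmap _ G.

Let mz0 : cmeasurable z0. Proof. exact: cmeasurable_coord. Qed.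
Let mhv : cmeasurable hv. Proof. exact: cmeasurable_head_vertex. Qed.
Let msh D : measurable D -> measurable (shift @^-1` D).
Proof. by move=> mD; exact: measurable_preimageT (@measurable_shiftmap _ G) _. Qed.

Let P (X : set (shift_space G)) : R := fine (m X).

Let PE X : measurable X -> m X = (P X)%:E.
Proof. by move=> mX; rewrite fineK // fin_num_measure. Qed.

Let PID X Y : measurable X -> measurable Y ->
  P X = P (X `\` Y) + P (X `&` Y).
Proof.
move=> mX mY; rewrite {1}/P (measureDI _ mX mY) fineD // fin_num_measure //.
- exact: measurableD.
- exact: measurableI.
Qed.

Variable A : set (shift_space G).
Hypothesis mA : measurable A.
Hypothesis Ainv : {ae m, forall z, A (shift z) -> A z}.

(** The preimage of [A] under the shift lies almost surely in [A] and has the same finite mass, so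
    the two differ by a null set. *)
Let Ainv_eq B : measurable B -> m (A `&` B) = m (shift @^-1` A `&` B).
Proof.
have mSA : measurable (shift @^-1` A) by exact: msh.
have SA : m (shift @^-1` A `&` A) = m A.
  rewrite -[RHS](shift_invariant mM) //; apply: ae_eq_measure => //.
    exact: measurableI.
  by apply: filterS Ainv => z Az; split=> [[]//|SAz]; split=> //; exact: Az.
have AS0 : m (A `\` shift @^-1` A) = 0%E.
  have mAS : measurable (A `\` shift @^-1` A) by exact: measurableD.
  have PA := PID mA mSA.
  have PSA : P (A `&` shift @^-1` A) = P A by rewrite /P setIC SA.
  by rewrite PE //; congr EFin; move: PA; rewrite PSA; lra.
move=> mB; apply: ae_eq_measure; do ?exact: measurableI.
have mD : measurable (A `\` shift @^-1` A) by exact: measurableD.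
have nD : {ae m, forall z, ~ (A `\` shift @^-1` A) z}.
  by exists (A `\` shift @^-1` A); split=> // z; exact: contrapT.
move: nD; apply: filterS2 Ainv => z Az nAS; split=> [[Az' Bz]|[/Az Az' Bz]//].
by split=> //; apply: contrapT => nSA; apply: nAS.
Qed.

(** The conditional probability of [A] given that the head vertex is [u], an event of mass [prob0 u]
    by stationarity. *)
Let q u := P (A `&` hv @^-1` [set u]) / prob0 u.

Let q_ge0 u : 0 <= q u.
Proof. by rewrite divr_ge0 ?fine_ge0 // ltW // prob0_gt0. Qed.

Let mAhv u : measurable (A `&` hv @^-1` [set u]).
Proof. by apply: measurableI => //; exact: mhv. Qed.

Let qE u : m (A `&` hv @^-1` [set u]) = (q u * prob0 u)%:E.
Proof. by rewrite PE // divfK // gt_eqF // prob0_gt0. Qed.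

(** Up to a null set [A] is an event about the shifted point. By the Markov property, its
    conditional probability given the first edge [g] is the one given the vertex [src g]. *)
Let edgeE g : m (A `&` z0 @^-1` [set g]) =
  ((q (src g))%:E * m (z0 @^-1` [set g]))%E.
Proof.
rewrite Ainv_eq; last exact: mz0.
rewrite setIC markov_property // qE markov_measure_edge // -!EFinM.
by rewrite mulrCA mulrA mulrAC mulrC mulrA.
Qed.

Let level_le t (F : set G) : 0 <= t -> (forall g, F g -> q (src g) <= t) ->
  P (A `&` z0 @^-1` F) <= t * P (z0 @^-1` F).
Proof.
move=> t0 Ft; have mF := cmeasurable_preimage F mz0.
rewrite -lee_fin EFinM -!PE //; last exact: measurableI.
rewrite -[X in (_ <= _ * m X)%E]setTI !measure_cmeasurable // -esumZl //.
apply: le_esum => g Fg; rewrite setTI [X in (X <= _)%E]edgeE.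
by rewrite lee_wpmul2r // lee_fin Ft.
Qed.

Let level_ge t (F : set G) : 0 <= t -> (forall g, F g -> t <= q (src g)) ->
  t * P (z0 @^-1` F) <= P (A `&` z0 @^-1` F).
Proof.
move=> t0 Ft; have mF := cmeasurable_preimage F mz0.
rewrite -lee_fin EFinM -!PE //; last exact: measurableI.
rewrite -[X in (_ * m X <= _)%E]setTI !measure_cmeasurable // -esumZl //.
apply: le_esum => g Fg; rewrite setTI [X in (_ <= X)%E]edgeE.
by rewrite lee_wpmul2r // lee_fin Ft.
Qed.

(** The source of the first edge is the target of the second, so invariance gives the events that
    the source is in [E] and that the target is in [E] equal mass within [B]. Removing their common
    part leaves the outgoing and incoming fluxes. *)
Let flux (E : set (vertex G)) B : measurable B ->
  (forall C, measurable C -> m (B `&` C) = m (shift @^-1` B `&` C)) ->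
  P (B `&` z0 @^-1` [set g | E (src g) /\ ~ E (tgt g)]) =
  P (B `&` z0 @^-1` [set g | ~ E (src g) /\ E (tgt g)]).
Proof.
move=> mB Binv.
pose S := z0 @^-1` [set g | E (src g)].
pose T := z0 @^-1` [set g | E (tgt g)].
have mS : measurable S by exact: cmeasurable_preimage.
have mT : measurable T by exact: cmeasurable_preimage.
have ST : P (B `&` S) = P (B `&` T).
  rewrite /P Binv // (_ : S = shift @^-1` T); last first.
    by apply/funext => z; rewrite /S /T /preimage /= /z0 shiftP.
  by rewrite -preimage_setI shift_invariant //; exact: measurableI.
move: ST; rewrite (PID (measurableI _ _ mB mS) mT).
rewrite (PID (measurableI _ _ mB mT) mS) -!setIA [T `&` S]setIC.
rewrite -!setIDA => /addIr.
have -> : S `\` T = z0 @^-1` [set g | E (src g) /\ ~ E (tgt g)] by [].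
by have -> : T `\` S = z0 @^-1` [set g | ~ E (src g) /\ E (tgt g)]
  by apply/seteqP; split=> z [].
Qed.

(* By invariance the flux of [A] out of the level set [{u | t < q u}] equals the
   flux into it.  Since the conditional probability of [A] given the edge [g] is
   [q (src g)], it is [> t] on outgoing edges and [<= t] on incoming ones, so no
   edge can leave the level set. *)
Let q_le u v : q u <= q v.
Proof.
pose t := q v; pose E := [set u | t < q u].
rewrite leNgt; apply/negP => tu; suff : E v by rewrite /E /= ltxx.
have Eu : E u by [].
apply: (@irreducible_closed R G E u v Girr _ Eu) => g Eg.
apply: contrapT => nEg.
pose F1 := [set g : G | E (src g) /\ ~ E (tgt g)].
pose F2 := [set g : G | ~ E (src g) /\ E (tgt g)].
have PA : P (A `&` z0 @^-1` F1) = P (A `&` z0 @^-1` F2) by exact: flux.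
have PT : P (z0 @^-1` F1) = P (z0 @^-1` F2).
  have := @flux E setT measurableT; rewrite preimage_setT !setTI; exact.
have mF1 : measurable (z0 @^-1` F1) by exact: cmeasurable_preimage.
have t0 : 0 <= t by exact: q_ge0.
have le2 : P (A `&` z0 @^-1` F2) <= t * P (z0 @^-1` F2).
  by apply: level_le => // h [/negP]; rewrite -leNgt.
(* The edge [g] is split off because it has positive mass and [q (src g)] exceeds [t]: this makes
   the comparison of fluxes strict, and the weak bound suffices on the other outgoing edges. *)
have le1 : t * P (z0 @^-1` (F1 `\` [set g])) <= P (A `&` z0 @^-1` (F1 `\` [set g])).
  by apply: level_ge => // h [[/ltW]].
have F1g : z0 @^-1` F1 `&` z0 @^-1` [set g] = z0 @^-1` [set g].
  by apply/seteqP; split=> [z []//|z /= zg]; split=> //=; rewrite zg.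
have dF : P (z0 @^-1` F1) =
    P (z0 @^-1` (F1 `\` [set g])) + prob g * prob0 (src g).
  by rewrite (PID mF1 (mz0 g)) F1g /P markov_measure_edge.
have dAF : P (A `&` z0 @^-1` F1) = P (A `&` z0 @^-1` (F1 `\` [set g])) +
    q (src g) * (prob g * prob0 (src g)).
  rewrite (PID (measurableI _ _ mA mF1) (mz0 g)) -setIDA -setIA F1g.
  by rewrite /P edgeE markov_measure_edge.
have : 0 < prob g * prob0 (src g) by rewrite mulr_gt0 ?prob_gt0 ?prob0_gt0.
move: Eg; rewrite /E /= => Eg pg.
have : t * (prob g * prob0 (src g)) < q (src g) * (prob g * prob0 (src g)).
  by rewrite ltr_pM2r.
nra.
Qed.

(** As [q] is a constant [c], the event [A] is independent of every cylinder, hence of every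
    measurable set and of itself. So [c] equals its square. *)
Lemma ergodic : m A = 0%E \/ m A = 1%E.
Proof.
have [u _] : exists u : vertex G, True.
  by have [x _] := shift_inhabited G; exists (tgt (x 0%N)).
pose c := q u.
have qc v : q v = c by apply: le_anti; rewrite !q_le.
have c0 : 0 <= c by exact: q_ge0.
have cylE n g : admissible n g -> m (A `&` cylinder n g) =
    (c%:E * m (cylinder n g))%E.
  elim: n g => [|n IHn] g gadm.
    rewrite (_ : cylinder 0 g = z0 @^-1` [set g 0%N]); first by rewrite edgeE qc.
    apply/seteqP; split=> [z /(_ 0%N)|z zg k]; first exact.
    by rewrite leqn0 => /eqP ->.
  pose g' k := g k.+1.
  have g'adm : admissible n g' by move=> k kn; exact: gadm.
  have mC := measurable_cylinder n g'.
  have -> : cylinder n.+1 g = z0 @^-1` [set g 0%N] `&` shift @^-1` cylinder n g'.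
    apply/seteqP; split=> [z zg|z [zg zg'] [|k] kn //]; last exact: zg'.
    by split=> [|k kn]; [exact: (zg 0%N)|exact: (zg k.+1)].
  have hvC : cylinder n g' `&` hv @^-1` [set src (g 0%N)] = cylinder n g'.
    apply/seteqP; split=> [z []//|z zg]; split=> //=.
    by rewrite /hv /head_vertex zg // gadm.
  rewrite Ainv_eq; last by apply: measurableI; [exact: mz0|exact: msh].
  rewrite setICA -preimage_setI !markov_property //; last exact: measurableI.
  by rewrite -setIA hvC IHn // muleCA.
have [m1 m1E] : exists m1 : {measure set (shift_space G) -> \bar R},
    forall X, m1 X = m (A `&` X).
  by exists (mrestr m mA) => X; rewrite setIC.
have [m2 m2E] : exists m2 : {measure set (shift_space G) -> \bar R},
    forall X, m2 X = (c%:E * m X)%E by exists (mscale (NngNum c0) m).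
have AX X : measurable X -> m (A `&` X) = (c%:E * m X)%E.
  move=> mX; rewrite -m1E -m2E; apply: eq_cylinder_measure => //.
    rewrite m1E setIT; apply: (@le_lt_trans _ _ 1%E); last exact: ltry.
    exact: probability_le1.
  by move=> n g gadm; rewrite m1E m2E cylE.
have Ac : m A = c%:E by rewrite -[A]setIT AX // probability_setT mule1.
have := AX _ mA; rewrite setIid Ac -EFinM => -[] /eqP.
rewrite eq_sym -subr_eq0 -{3}[c]mulr1 -mulrBr mulf_eq0 subr_eq0.
by case/orP => /eqP ->; [left|right].
Qed.

End Ergodicity.

(** * Disintegration over the Bernoulli shift *)

Section FactorMapTheory.
Variables (R : realType) (G H : stochGraph R) (phi : graph_hom G H).

Lemma measurable_factor_map : measurable_fun setT (factor_map phi).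
Proof.
apply: measurable_into_shift => n.
exact: (cmeasurable_comp phi (cmeasurable_coord n)).
Qed.

Lemma factor_map_iter_shift n z :
  factor_map phi (iter n (@shiftmap _ G) z) =
  iter n (@shiftmap _ H) (factor_map phi z).
Proof.
by apply: markov_shift_ext => k; rewrite /= !iter_shiftmapE.
Qed.

Lemma factor_map_shift z :
  factor_map phi (shiftmap z) = shiftmap (factor_map phi z).
Proof. exact: (factor_map_iter_shift 1). Qed.

Lemma graph_hom_inj (g g' : G) : src g = src g' -> phi g = phi g' -> g = g'.
Proof.
have [phi0 [st _ bij _]] := graph_homP phi => sg pg.
by have [_ inj _] := bij (src g); apply: inj => //; rewrite inE.
Qed.

End FactorMapTheory.

(** * Labels of a uniform graph and their independence *)

Section UniformGraph.
Variables (R : realType) (I : countType) (rho : I -> R).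
Variables (rho_gt0 : forall i, 0 < rho i).
Variables (rho_sum : (\esum_(i in [set: I]) (rho i)%:E = 1)%E).
Let K := bernoulli_graph rho_gt0 rho_sum.
Variables (G : stochGraph R) (phi : graph_hom G K).

Lemma labelled_edge : exists e : vertex G -> I -> G,
  forall u i, src (e u i) = u /\ phi (e u i) = i.
Proof.
have ex (p : vertex G * I) : exists g, src g = p.1 /\ phi g = p.2.
  have [phi0 [st _ bij _]] := graph_homP phi.
  have [_ _ sur] := bij p.1.
  have [|g gs gi] := sur p.2; last by exists g.
  by rewrite /=; case: (phi0 p.1).
have [e eP] := choice ex; exists (fun u i => e (u, i)) => u i.
exact: (eP (u, i)).
Qed.

Lemma prob_label (g : G) : prob g = rho (phi g).
Proof. by have [phi0 [_ _ _ <-]] := graph_homP phi. Qed.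

Variables (m : probability (shift_space G) R).
Hypothesis mM : is_markov_measure m.

(** Every vertex emits exactly one edge with label [i], and its weight is [rho i]. Summing
    [markov_property] over the vertices therefore takes out the common factor. *)
Lemma label_independent (i : I) (D : set (shift_space G)) : measurable D ->
  m ([set z : shift_space G | phi (z 0%N) = i] `&` @shiftmap _ G @^-1` D) =
  ((rho i)%:E * m D)%E.
Proof.
move=> mD; have [e eP] := labelled_edge.
have mz0 := @cmeasurable_coord _ G 0%N.
have mSD := measurable_preimageT (@measurable_shiftmap _ G) mD.
rewrite setIC.
transitivity (\esum_(g in [set g : G | phi g = i])
    m (@shiftmap _ G @^-1` D `&` (fun z : shift_space G => z 0%N) @^-1` [set g]))%E.
  exact: (measure_cmeasurable m [set g : G | phi g = i] mz0 mSD).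
transitivity (\esum_(u in [set: vertex G])
    ((rho i)%:E * m (D `&` @head_vertex _ G @^-1` [set u])))%E.
  rewrite (_ : [set g | _] = (e^~ i) @` setT); last first.
    apply/seteqP; split=> [g gi|_ [u _ <-]]; last by have [] := eP u i.
    exists (src g) => //; have [es ei] := eP (src g) i.
    exact: graph_hom_inj es (etrans ei (esym gi)).
  rewrite esum_image; last first.
    by move=> u v _ _ uv; rewrite -(eP u i).1 uv (eP v i).1.
  apply: eq_esum => u _; rewrite setIC markov_property //.
  by rewrite prob_label (eP u i).1 (eP u i).2.
rewrite esumZl ?ltW //; congr (_ * _)%E.
rewrite -[in RHS](setIT D).
exact/esym/(measure_cmeasurable m setT (@cmeasurable_head_vertex _ G) mD).
Qed.

End UniformGraph.

Section BernoulliShift.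
Variables (R : realType) (I : countType) (rho : I -> R).
Variables (rho_gt0 : forall i, 0 < rho i).
Variables (rho_sum : (\esum_(i in [set: I]) (rho i)%:E = 1)%E).
Let K := bernoulli_graph rho_gt0 rho_sum.
Local Notation X := (shift_space K).
Variables (m : probability X R).
Hypothesis mM : is_markov_measure m.

Lemma bernoulli_independent (i : I) (D : set X) : measurable D ->
  m ([set x : X | x 0%N = i] `&` @shiftmap _ K @^-1` D) = ((rho i)%:E * m D)%E.
Proof.
move=> mD; rewrite [LHS](markov_property mM (i : K) mD).
congr (_ * m _)%E; apply/seteqP; split=> [x []//|x Dx]; split=> //=.
Qed.

Lemma prepend_subproof (i : I) (x : X) n :
  src ((fun k => if k is k'.+1 then x k' else i : K) n) =
  tgt ((fun k => if k is k'.+1 then x k' else i : K) n.+1).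
Proof. by []. Qed.

(** The inverse branch of the shift for the letter [i], defined everywhere because [K] has a single
    vertex. *)
Definition prepend (i : I) (x : X) : X :=
  MarkovShift (prepend_subproof i x).

Lemma measurable_prepend (i : I) : measurable_fun setT (prepend i).
Proof.
apply: measurable_into_shift => -[|n]; last exact: cmeasurable_coord.
move=> c; have [<-|ic] := pselect (i = c).
  by rewrite (_ : _ @^-1` _ = setT) //; apply/seteqP; split.
by rewrite (_ : _ @^-1` _ = set0) //; apply/seteqP; split=> // x /= /ic.
Qed.

Lemma shift_prepend i x : shiftmap (prepend i x) = x.
Proof. exact: markov_shift_ext. Qed.

Lemma prepend_shift (x : X) : prepend (x 0%N) (shiftmap x) = x.
Proof. by apply: markov_shift_ext => -[]. Qed.

Lemma prependE (i : I) (E : set X) : E `<=` [set x : X | x 0%N = i] ->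
  E = [set x : X | x 0%N = i] `&` @shiftmap _ K @^-1` (prepend i @^-1` E).
Proof.
move=> Ei; apply/seteqP; split=> [x Ex|x [<-]]; last first.
  by rewrite /preimage /= prepend_shift.
split; first exact: Ei.
by rewrite /preimage /= -(Ei x Ex) prepend_shift.
Qed.

(** On the event that the first letter is [i], independence makes [m] the image under [prepend i] of
    [rho i] times [m]; the formula is this change of variables. *)
Lemma integral_prepend (i : I) (E : set X) (f : X -> \bar R) : measurable E ->
  E `<=` [set x : X | x 0%N = i] ->
  measurable_fun setT f -> (forall x, 0 <= f x)%E ->
  (\int[m]_(x in E) f x =
   (rho i)%:E * \int[m]_(x in prepend i @^-1` E) f (prepend i x))%E.
Proof.
move=> mE Ei mf f0.
have mpE := measurable_preimageT (measurable_prepend i) mE.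
rewrite -(ge0_integral_pushforward (measurable_prepend i) m mE (measurable_funTS mf)) //.
rewrite -(ge0_integral_mscale _ _ (NngNum (ltW (rho_gt0 i)))) //; last exact: measurable_funTS.
  exact: measurable_prepend.
move=> mprep; apply: eq_measure_integral => B mB BE.
have -> : B = [set x : X | x 0%N = i] `&` @shiftmap _ K @^-1` (prepend i @^-1` B).
  by apply: prependE => x /BE /Ei.
rewrite [LHS]bernoulli_independent; last exact: (measurable_preimageT (measurable_prepend i)).
rewrite /mscale /= /pushforward; congr (_ * m _)%E.
by apply/seteqP; split=> x /=; rewrite shift_prepend // => -[].
Qed.

End BernoulliShift.

Section CanonicalTuple.
Variables (T : choiceType) (n : nat).
Implicit Types s t : n.-tuple T.

(** A normal form for the multiset of entries. [T] carries no order to sort by, so [choose] selects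
    one arrangement, the same for all permutations of [t]. *)
Definition canonical_tuple t : n.-tuple T :=
  choose (fun s : n.-tuple T => perm_eq t s) t.

Lemma perm_canonical_tuple t : perm_eq t (canonical_tuple t).
Proof. exact: (@chooseP _ (fun s : n.-tuple T => perm_eq t s) t). Qed.

Lemma eq_canonical_tuple s t :
  perm_eq s t -> canonical_tuple s = canonical_tuple t.
Proof.
move=> st; rewrite /canonical_tuple.
rewrite (eq_choose (Q := fun r : n.-tuple T => perm_eq t r)); last first.
  by move=> r; exact: (permPl st).
by apply: choose_id => //; rewrite perm_sym.
Qed.

End CanonicalTuple.

Section Disintegration.
Variables (R : realType) (I : countType) (rho : I -> R).
Variables (rho_gt0 : forall i, 0 < rho i).
Variables (rho_sum : (\esum_(i in [set: I]) (rho i)%:E = 1)%E).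
Let K := bernoulli_graph rho_gt0 rho_sum.
Variables (G : stochGraph R) (phi : graph_hom G K) (d : nat).
Local Notation X := (shift_space K).
Local Notation Z := (shift_space G).
Variables (mG : probability Z R) (mK : probability X R).
Variables (kappa : R.-pker X ~> Z).
Hypothesis mGM : is_markov_measure mG.
Hypothesis mKM : is_markov_measure mK.
Hypothesis mG_kappa :
  forall A, measurable A -> mG A = (\int[mK]_x kappa x A)%E.

Definition is_fibre (x : X) (y : 'I_d -> Z) : Prop :=
  [/\ injective y,
      forall i, factor_map phi (y i) = x &
      forall A, measurable A ->
        kappa x A = ((d%:R^-1)%:E * \sum_(i < d) \d_(y i) A)%E].

Hypothesis ae_fibre : {ae mK, forall x, exists y, is_fibre x y}.

Let measurable_kappa A : measurable A ->
  measurable_fun [set: X] (fun x => kappa x A).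
Proof. exact: measurable_kernel. Qed.

(** Almost every [kappa x] is carried by the fibre over [x], so intersecting with the preimage of
    [B] keeps all of [kappa x] when [x] is in [B] and nothing otherwise. *)
Lemma disintegration (A : set Z) (B : set X) : measurable A -> measurable B ->
  mG (A `&` factor_map phi @^-1` B) = (\int[mK]_(x in B) kappa x A)%E.
Proof.
move=> mA mB.
have mPB := measurable_preimageT (measurable_factor_map phi) mB.
have mAB := measurableI _ _ mA mPB.
rewrite mG_kappa // [RHS]integral_mkcond; apply: ge0_ae_eq_integral => //.
- exact: measurable_kappa.
- apply/(measurable_restrictT _ mB).
  exact: measurable_funTS (measurable_kappa mA).
- by move=> x _; rewrite /patch; case: ifP.
apply: filterS ae_fibre => x [y [_ yx kx]] _.
rewrite kx // /patch; case: ifPn => xB.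
  rewrite kx //; congr (_ * _)%E; apply: eq_bigr => i _; rewrite !diracE.
  congr (_%:R%:E); rewrite in_setI [X in _ && X](_ : _ = true) ?andbT //.
  by apply: mem_set; rewrite /= yx; exact: set_mem.
rewrite big1 ?mule0 // => i _; rewrite diracE memNset // => -[_ /= yB].
by move/negP: xB; apply; apply: mem_set; rewrite -(yx i).
Qed.

Lemma factor_measure (B : set X) : measurable B ->
  mG (factor_map phi @^-1` B) = mK B.
Proof.
move=> mB; rewrite -[_ @^-1` _]setTI disintegration //.
under eq_integral do rewrite prob_kernel.
by rewrite integral_cst // mul1e.
Qed.

Lemma ae_factor (P : X -> Prop) :
  {ae mK, forall x, P x} -> {ae mG, forall z, P (factor_map phi z)}.
Proof.
apply: ae_comp; first exact: measurable_factor_map.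
by move=> N mN N0; rewrite -[RHS]N0; exact: factor_measure.
Qed.

Let kappa_le1 x A : measurable A -> (kappa x A <= 1)%E.
Proof.
by move=> mA; rewrite -(@prob_kernel _ _ _ _ _ kappa x); apply: le_measure; rewrite ?inE.
Qed.

(** The shifted point is independent of the first label, so its conditional law given [x] depends on
    [shiftmap x] only. This is tested by integrating both sides over events [E] on which the first
    letter is a fixed [i]. *)
Lemma kappa_shift (A : set Z) : measurable A ->
  {ae mK, forall x, kappa x (@shiftmap _ G @^-1` A) = kappa (shiftmap x) A}.
Proof.
move=> mA.
have mSA := measurable_preimageT (@measurable_shiftmap _ G) mA.
have mk2 : measurable_fun [set: X] (fun x => kappa (shiftmap x) A).
  exact: measurableT_comp (measurable_kappa mA) (@measurable_shiftmap _ K).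
have : {ae mK, forall x : X, forall i : I, x 0%N = i ->
    kappa x (@shiftmap _ G @^-1` A) = kappa (shiftmap x) A}.
  apply: ae_forall => i.
  have mi : measurable [set x : X | x 0%N = i] by exact: (@cmeasurable_coord _ K 0 i).
  apply: (integral_ae_eq mi).
  - apply: (@le_integrable _ _ _ _ _ mi _ (cst 1%E)) => //.
    + exact: measurable_funTS (measurable_kappa mSA).
    + by move=> x _; rewrite gee0_abs // abse1; exact: kappa_le1.
    + exact: finite_measure_integrable_cst.
  - exact: measurable_funTS.
  move=> E Ei mE.
  have mpE := measurable_preimageT (measurable_prepend i) mE.
  rewrite -disintegration // (integral_prepend mKM mE Ei mk2) //.
  under eq_integral do rewrite shift_prepend.
  rewrite -disintegration // -(label_independent phi mGM i); last first.
    apply: measurableI => //.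
    exact: (measurable_preimageT (measurable_factor_map phi)).
  congr (mG _); rewrite {1}(prependE Ei).
  by apply/seteqP; split=> z /=; rewrite -factor_map_shift; [move=> [? []]|move=> [? []]].
by apply: filterS => x; exact.
Qed.

Definition vertex_at n (u : vertex G) : set Z :=
  [set z | head_vertex (iter n (@shiftmap _ G) z) = u].

Lemma measurable_vertex_at n u : measurable (vertex_at n u).
Proof.
exact: (measurable_preimageT (@measurable_iter_shiftmap _ G n)
  (@cmeasurable_head_vertex _ G u)).
Qed.

Lemma kappa_vertex_at : {ae mK, forall x, forall n u,
  kappa x (vertex_at n u) = kappa (iter n (@shiftmap _ K) x) (vertex_at 0 u)}.
Proof.
apply: ae_foralln; elim=> [|n IHn]; first exact: aeW.
have := ae_iter_shift mKM 1 IHn.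
have := ae_forall (fun u => kappa_shift (measurable_vertex_at n u)).
apply: filterS2 => x E1 E2 u.
rewrite iterSr -E2 -E1; congr (kappa x _).
by apply/funext => z; rewrite /vertex_at /preimage /= -iterSr.
Qed.

(** * The set of vertices occupied by a fibre *)

Hypothesis d_gt0 : (0 < d)%N.
Local Notation V := (vertex G).
Variable f : I -> V -> V.
Hypothesis fE : forall g : G, tgt g = f (phi g) (src g).
Variable v0 : V.

Let shX := @shiftmap _ K.
Let shZ := @shiftmap _ G.

(* Sets and multisets of [d] vertices are encoded as canonically ordered tuples. *)
Definition fibre_law (x : X) (t : d.-tuple V) : Prop :=
  forall u, kappa x (vertex_at 0 u) = ((count_mem u t)%:R / d%:R)%:E.

(** Read off from the kernel and not from chosen points of the fibre, which makes measurability in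
    [x] accessible. The tuple of copies of [v0] is a default for the null set where no law
    exists. *)
Definition fibre_vertices (x : X) : d.-tuple V :=
  canonical_tuple (xget (nseq_tuple d v0) [set t | fibre_law x t]).

Lemma fibre_law_perm x s t : fibre_law x s -> fibre_law x t -> perm_eq s t.
Proof.
move=> sx tx; apply/allP => u _ /=; have := sx u; rewrite tx => -[].
have d0 : (d%:R : R) != 0 by rewrite pnatr_eq0 -lt0n.
by move/(divIf d0)/eqP; rewrite eqr_nat eq_sym.
Qed.

Lemma fibre_lawE x t : fibre_law x t -> fibre_vertices x = canonical_tuple t.
Proof.
move=> xt; apply: eq_canonical_tuple; apply: fibre_law_perm (xt).
exact: (@xgetPex _ (nseq_tuple d v0) [set s | fibre_law x s] (ex_intro _ t xt)).
Qed.

Lemma measurable_fibre_law t : measurable [set x | fibre_law x t].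
Proof.
apply: measurable_forall => u.
have := measurable_kernel kappa _ (measurable_vertex_at 0 u) measurableT
  [set ((count_mem u t)%:R / d%:R)%:E] (emeasurable_set1 _).
by rewrite setTI.
Qed.

Lemma cmeasurable_fibre_vertices : cmeasurable fibre_vertices.
Proof.
move=> t; pose L := [set x | exists s, fibre_law x s].
have mL : measurable L by exact: (measurable_exists measurable_fibre_law).
have mt : measurable [set x : X | exists s : d.-tuple V,
    fibre_law x s /\ canonical_tuple s = t].
  apply: (measurable_exists (P := fun s : d.-tuple V =>
    [set x : X | fibre_law x s /\ canonical_tuple s = t])) => s.
  have [st|st] := pselect (canonical_tuple s = t).
    rewrite (_ : [set _ | _] = [set x | fibre_law x s]).
      exact: measurable_fibre_law.
    by apply/seteqP; split=> x // -[].
  by rewrite (_ : [set _ | _] = set0) //; apply/seteqP; split=> x // -[].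
have m0 : measurable (~` L `&`
    [set x : X | canonical_tuple (nseq_tuple d v0) = t]).
  apply: measurableI; first exact: measurableC.
  have [vt|vt] := pselect (canonical_tuple (nseq_tuple d v0) = t).
    by rewrite (_ : [set _ | _] = setT) //; apply/seteqP; split.
  by rewrite (_ : [set _ | _] = set0) //; apply/seteqP; split.
rewrite (_ : _ @^-1` _ = [set x : X | exists s : d.-tuple V,
    fibre_law x s /\ canonical_tuple s = t] `|` (~` L `&`
    [set x : X | canonical_tuple (nseq_tuple d v0) = t])).
  exact: measurableU.
apply/seteqP; split=> [x /= xt|x [[s [xs <-]]|[nL <-]]].
- have [[s xs]|nL] := pselect (L x); [left|right].
    by exists s; split=> //; rewrite -(fibre_lawE xs).
  split=> //=; rewrite -xt /fibre_vertices xgetPN // => s xs; apply: nL.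
  by exists s.
- exact: fibre_lawE.
- by rewrite /= /fibre_vertices xgetPN // => s xs; apply: nL; exists s.
Qed.

Definition vertices_at n (y : 'I_d -> Z) : d.-tuple V :=
  [tuple head_vertex (iter n shZ (y i)) | i < d].

Lemma fibre_count x y n u : is_fibre x y ->
  kappa x (vertex_at n u) = ((count_mem u (vertices_at n y))%:R / d%:R)%:E.
Proof.
move=> [_ _ kx]; rewrite kx; last exact: measurable_vertex_at.
under eq_bigr do rewrite diracE.
rewrite sumEFin -EFinM mulrC; congr (_ / _)%:E.
rewrite -natr_sum; congr (_%:R).
rewrite /= count_map -sum1_count [RHS]big_mkcond /= big_enum /=.
apply: eq_bigr => i _; case: eqVneq => [iu|/eqP iu].
  by rewrite mem_set.
by rewrite memNset.
Qed.

(** Ties the points of a single fibre to [fibre_vertices] along the whole orbit of [x]: by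
    [kappa_vertex_at], their vertices at time [n] follow the law attached to the [n]-th shift of
    [x]. *)
Lemma ae_fibre_vertices : {ae mK, forall x, exists y,
  is_fibre x y /\
  forall n, fibre_law (iter n shX x) (vertices_at n y)}.
Proof.
have := kappa_vertex_at.
apply: filterS2 ae_fibre => x [y xy] kx; exists y; split=> // n u.
by rewrite -kx (fibre_count _ _ xy).
Qed.

Lemma head_vertex_step (z : Z) :
  head_vertex z = f (phi (z 0%N)) (head_vertex (shZ z)).
Proof. by rewrite /head_vertex fE shiftP. Qed.

Lemma vertices_at_step x y n : is_fibre x y ->
  vertices_at n y = map_tuple (f (x n)) (vertices_at n.+1 y).
Proof.
move=> [_ yx _]; apply: eq_from_tnth => i; rewrite [RHS]tnth_map /vertices_at !tnth_mktuple.
rewrite head_vertex_step iter_shiftmapE addn0; congr (f _ _).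
by rewrite -(yx i).
Qed.

(** Labels act deterministically towards smaller indices: at equal vertices the common label forces
    equal edges, hence equal next vertices. *)
Lemma merging_points x y (i j : 'I_d) n k : is_fibre x y ->
  (k < n)%N -> tgt (y i n) = tgt (y j n) -> y i k = y j k.
Proof.
move=> [_ yx _]; elim: n => // n IHn; rewrite ltnS => kn ij.
have ijn : y i n = y j n.
  apply: (graph_hom_inj (phi := phi)); first by rewrite !shiftP.
  by have := yx j; rewrite -(yx i) => /(congr1 (fun x : X => x n)).
move: kn; rewrite leq_eqVlt => /predU1P[-> //|kn].
by apply: IHn => //; rewrite ijn.
Qed.

(** Two distinct points of the fibre differ at some index, and by [merging_points] they cannot share
    a vertex at any larger one. There are finitely many pairs. *)
Lemma eventually_uniq x y : is_fibre x y ->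
  exists N, forall n, (N <= n)%N -> uniq (vertices_at n y).
Proof.
move=> xy; have [yI _ _] := xy.
have ex (p : 'I_d * 'I_d) : exists k, p.1 <> p.2 -> y p.1 k <> y p.2 k.
  have [p12|p12] := pselect (p.1 = p.2); first by exists 0%N.
  apply: contrapT => np; apply/p12/yI/markov_shift_ext => k.
  by apply: contrapT => pk; apply: np; exists k.
have [N NP] := choice ex.
(* The successor is there because [merging_points] only compares edges at indices strictly below the
   common vertex. *)
exists (\max_p N p).+1 => n Nn.
rewrite map_inj_uniq ?enum_uniq // => i j ij; apply: contrapT => nij.
apply: (NP (i, j) nij); apply: (merging_points (n := n) xy).
  by apply: leq_trans Nn; rewrite ltnS; exact: leq_bigmax.
by have := ij; rewrite /head_vertex !iter_shiftmapE addn0.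
Qed.

(* The probability of having no collision at time [N] does not depend on [N],
   and tends to 1. *)
Lemma ae_uniq_fibre_vertices : {ae mK, forall x, uniq (fibre_vertices x)}.
Proof.
pose U := [set x | uniq (fibre_vertices x)].
have mU : measurable U.
  exact: (cmeasurable_preimage [set t : d.-tuple V | uniq t]
    cmeasurable_fibre_vertices).
pose W N := [set x | forall n, (N <= n)%N -> U (iter n shX x)].
have mW N : measurable (W N).
  apply: measurable_forall_nat => n; apply: measurable_imply.
  exact: (measurable_preimageT (@measurable_iter_shiftmap _ K n) mU).
have mWT : measurable (\bigcup_N W N) by exact: bigcupT_measurable.
have WT : mK (\bigcup_N W N) = 1%E.
  rewrite -[RHS](@probability_setT _ _ _ mK); apply: ae_eq_measure => //.
  apply: filterS ae_fibre_vertices => x [y [xy xyn]]; split=> // _.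
  have [N NP] := eventually_uniq xy; exists N => // n Nn.
  rewrite /U /= (fibre_lawE (xyn n)).
  by rewrite -(perm_uniq (perm_canonical_tuple _)); exact: NP.
have Wnd : {homo W : n k / (n <= k)%N >-> (n <= k)%O}.
  move=> n k nk; apply/subsetPset => x Wx j kj; apply: Wx.
  exact: leq_trans nk kj.
have U1 : (1 <= mK U)%E.
  rewrite -WT; apply: (cvge_le _ (nondecreasing_cvg_mu mW mWT Wnd)).
  apply: nearW => N /=.
  rewrite -(iter_shift_invariant mKM N mU); apply: le_measure; rewrite ?inE //.
    exact: (measurable_preimageT (@measurable_iter_shiftmap _ K N) mU).
  by move=> x; apply.
have UE : mK U = 1%E by apply/eqP; rewrite eq_le U1 probability_le1.
have UC : mK (~` U) = 0%E by rewrite probability_setC // UE subee.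
by exists (~` U); split=> //; exact: measurableC.
Qed.

Lemma fibre_vertices_step : {ae mK, forall x,
  fibre_law x (fibre_vertices x) /\
  perm_eq (map (f (x 0%N)) (fibre_vertices (shX x))) (fibre_vertices x) /\
  fibre_vertices x =
    canonical_tuple (map_tuple (f (x 0%N)) (fibre_vertices (shX x)))}.
Proof.
apply: filterS ae_fibre_vertices => x [y [xy xyn]].
have E0 := fibre_lawE (xyn 0%N); have E1 := fibre_lawE (xyn 1%N).
have P1 : perm_eq (map (f (x 0%N)) (fibre_vertices (shX x)))
    (vertices_at 0 y).
  rewrite (vertices_at_step 0 xy) /= E1 perm_sym.
  exact/perm_map/perm_canonical_tuple.
split; [|split].
- move=> u; rewrite [LHS](xyn 0%N u) E0; congr (_%:R / _)%:E.
  exact/seq.permP/perm_canonical_tuple.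
- by rewrite (perm_trans P1) // E0 perm_canonical_tuple.
- by rewrite E0; apply: eq_canonical_tuple; rewrite perm_sym.
Qed.

(* [w s] lists the elements of the d-subset coded by the state [s]. *)
Lemma fibre_coding : exists (W : countType) (tau : X -> W)
    (w : W -> d.-tuple V) (step : I -> W -> W) (a : I -> W -> {perm 'I_d}),
  [/\ cmeasurable tau,
      forall s, mK (tau @^-1` [set s]) != 0%E,
      {ae mK, forall x, tau x = step (x 0%N) (tau (shX x))} &
      [/\ forall s, uniq (w s),
          forall i s y, tnth (w (step i s)) (a i s y) = f i (tnth (w s) y) &
          {ae mK, forall x, forall u,
            kappa x (vertex_at 0 u) = ((u \in w (tau x))%:R / d%:R)%:E}]].
Proof.
(* Only tuples of positive mass become states, so that almost sure facts can be checked at each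
   state by [ae_exists]. *)
pose pos := [set t | mK (fibre_vertices @^-1` [set t]) != 0%E].
have mfv := cmeasurable_fibre_vertices.
have ae_pos : {ae mK, forall x, pos (fibre_vertices x)}.
  exists (fibre_vertices @^-1` (~` pos)); split=> //.
    exact: cmeasurable_preimage.
  rewrite -[_ @^-1` _]setTI measure_cmeasurable // esum1 // => t.
  by rewrite setTI => /negP/negPn/eqP.
pose good x := [/\ pos (fibre_vertices x), uniq (fibre_vertices x) &
  fibre_law x (fibre_vertices x) /\
  perm_eq (map (f (x 0%N)) (fibre_vertices (shX x))) (fibre_vertices x) /\
  fibre_vertices x =
    canonical_tuple (map_tuple (f (x 0%N)) (fibre_vertices (shX x)))].
have ae_good0 : {ae mK, forall x, good x}.
  have := fibre_vertices_step; have := ae_uniq_fibre_vertices.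
  by apply: filterS3 ae_pos => x *; split.
have ae_good : {ae mK, forall x, good x /\ good (shX x)}.
  have := ae_iter_shift mKM 1 ae_good0.
  by apply: filterS2 ae_good0 => x *; split.
have [x0 _ [[pos0 _ _] _]] : exists2 x, setT x & good x /\ good (shX x).
  apply: (ae_exists measurableT _ ae_good).
  by rewrite [X in X != _](probability_setT mK) onee_eq0.
pose W : countType := {t : d.-tuple V | `[< pos t >]}.
(* Default for [insubd], returned only for tuples of mass zero. *)
pose s0 : W := Sub (fibre_vertices x0) (asboolT pos0).
pose tau x : W := insubd s0 (fibre_vertices x).
have tauE x : good x -> val (tau x) = fibre_vertices x.
  by move=> [px _ _]; rewrite insubdK // unfold_in; exact/asboolP.
pose step i (s : W) : W :=
  insubd s0 (canonical_tuple (map_tuple (f i) (val s))).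
have tau_step x : good x -> good (shX x) -> tau x = step (x 0%N) (tau (shX x)).
  move=> [_ _ [_ [_ E]]] gx; rewrite /step tauE //.
  by rewrite /tau {1}E.
have mtau : cmeasurable tau by exact: cmeasurable_comp.
have mass s : mK (tau @^-1` [set s]) != 0%E.
  rewrite (_ : mK _ = mK (fibre_vertices @^-1` [set val s])).
    exact/asboolP/(valP s).
  apply: ae_eq_measure; [exact: mtau|exact: mfv|].
  apply: filterS ae_good0 => x gx; split=> /= [<-|xs]; first by rewrite tauE.
  by apply: val_inj; rewrite tauE.
(* By independence, letter [p.1] followed by state [p.2] has positive mass. The event thus contains
   a good point, where the permutation can be read off, and [a] exists for every pair. *)
have ex (p : I * W) : exists a : {perm 'I_d}, forall y,
    tnth (val (step p.1 p.2)) (a y) = f p.1 (tnth (val p.2) y).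
  have [x [xi xs] [gx gsx]] : exists2 x,
      ([set x : X | x 0%N = p.1] `&` shX @^-1` (tau @^-1` [set p.2])) x &
      good x /\ good (shX x).
    apply: (ae_exists _ _ ae_good).
      apply: measurableI; first exact: (@cmeasurable_coord _ K 0 p.1).
      exact: (measurable_preimageT (@measurable_shiftmap _ K) (mtau _)).
    rewrite [X in X != _](bernoulli_independent mKM) //.
    by rewrite mule_neq0 // ?mass // eqe gt_eqF.
  have [_ _ [_ [/tuple_permP[a aE] _]]] := gx.
  have stepE : step p.1 p.2 = tau x by rewrite tau_step // xi xs.
  exists a => y; rewrite stepE tauE // -xi -xs tauE //.
  have -> : f (x 0%N) (tnth (fibre_vertices (shX x)) y) =
    tnth (map_tuple (f (x 0%N)) (fibre_vertices (shX x))) y by rewrite tnth_map.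
  rewrite [in RHS](_ : map_tuple _ _ = [tuple tnth (fibre_vertices x) (a i) | i < d]).
    by rewrite tnth_mktuple.
  exact: val_inj.
have [a aE] := choice ex.
exists W, tau, val, step, (fun i s => a (i, s)); split=> //.
  by apply: filterS ae_good => x [gx gsx]; exact: tau_step.
split.
- move=> s; have [x xs gx] := ae_exists (mtau s) (mass s) ae_good0.
  by move: xs gx => /= <- gx; rewrite tauE //; case: gx.
- by move=> i s y; exact: (aE (i, s)).
- apply: filterS ae_good0 => x gx u; have [_ ux [fl _]] := gx.
  by rewrite tauE // fl count_uniq_mem.
Qed.

End Disintegration.

(** * Homomorphisms of degree one *)

Section Lifting.
Variables (R : realType) (G L : stochGraph R) (gamma : graph_hom L G).
Local Notation Z := (shift_space G).
Variable m : probability Z R.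
Hypothesis mM : is_markov_measure m.
Variable v : Z -> vertex L.
Hypothesis mv : cmeasurable v.
Hypothesis m_v : forall u, m (v @^-1` [set u]) = (prob0 u)%:E.

Let sh := @shiftmap _ G.

Definition is_lift_edge (u u' : vertex L) (g : G) (l : L) : Prop :=
  [/\ src l = u, tgt l = u' & gamma l = g].

Hypothesis ae_edge : {ae m, forall z : Z,
  exists l, is_lift_edge (v (sh z)) (v z) (z 0%N) l}.

Lemma markov_cylinder n (g : nat -> G) (D : set Z) : measurable D ->
  admissible n g -> D `<=` [set z | head_vertex z = src (g n)] ->
  m (cylinder n g `&` iter n.+1 sh @^-1` D) =
  ((\prod_(k < n.+1) prob (g k))%:E * m D)%E.
Proof.
move=> mD; elim: n g => [|n IHn] g gadm Dg.
  rewrite big_ord_recl big_ord0 mulr1.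
  rewrite (_ : cylinder 0 g = (fun z : Z => z 0%N) @^-1` [set g 0%N]); last first.
    apply/seteqP; split=> [z /(_ 0%N)|z zg k]; first exact.
    by rewrite leqn0 => /eqP ->.
  rewrite markov_property //; congr (_ * m _)%E.
  by apply/seteqP; split=> [z []//|z Dz]; split=> //; exact: Dg.
pose g' k := g k.+1.
have mS := measurable_preimageT (@measurable_iter_shiftmap _ G n.+1) mD.
have mC := measurable_cylinder n g'.
have g'adm : admissible n g' by move=> k kn; exact: gadm.
have -> : cylinder n.+1 g `&` iter n.+2 sh @^-1` D =
    (fun z : Z => z 0%N) @^-1` [set g 0%N] `&`
    sh @^-1` (cylinder n g' `&` iter n.+1 sh @^-1` D).
  apply/seteqP; split=> [z [zg Dz]|z [zg [zg' Dz]]].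
    split; first exact: (zg 0%N).
    split; first by move=> k kn; exact: (zg k.+1).
    by change (D (iter n.+1 sh (sh z))); rewrite -iterSr.
  split; first by move=> [|k] kn //; exact: zg'.
  by change (D (iter n.+2 sh z)); rewrite iterSr.
rewrite markov_property //; last exact: measurableI.
rewrite [X in m X](_ : _ = cylinder n g' `&` iter n.+1 sh @^-1` D); last first.
  apply/seteqP; split=> [z []//|z [zg Dz]]; split=> //.
  by rewrite /= /head_vertex zg // gadm.
by rewrite IHn // [in RHS]big_ord_recl EFinM muleA.
Qed.

Lemma ae_lift_edge : {ae m, forall z : Z, forall n,
  exists l, is_lift_edge (v (iter n.+1 sh z)) (v (iter n sh z)) (z n) l}.
Proof.
apply: ae_foralln => n; apply: filterS (ae_iter_shift mM n ae_edge) => z.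
by rewrite iter_shiftmapE addn0.
Qed.

(** The value [v z] serves as the head vertex of a point of [L] above [z]. Its values along the
    orbit, together with the edges of [z], determine the lift [Psi z], so the conditional measures
    are Dirac masses and the measure on the shift of [L] is the image of [m]. *)
Lemma lift_has_degree1 : has_degree gamma 1.
Proof.
have [x0 _] := shift_inhabited L; pose l0 : L := x0 0%N.
(* An edge of [L] is recovered from its source and its image, uniquely by [graph_hom_inj]; [l0] is
   returned where there is none. *)
pose E (p : vertex L * G) : L :=
  xget l0 [set l | src l = p.1 /\ gamma l = p.2].
have EP u u' g l : is_lift_edge u u' g l -> E (u, g) = l.
  move=> [lu lu' lg]; have [sE gE] : src (E (u, g)) = u /\ gamma (E (u, g)) = g.
    exact: (@xgetPex _ l0 [set l | src l = u /\ gamma l = g]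
      (ex_intro _ l (conj lu lg))).
  by apply: (graph_hom_inj (phi := gamma)); rewrite ?sE ?gE.
pose e n (z : Z) : L := E (v (iter n.+1 sh z), z n).
have me n : cmeasurable (e n).
  apply: (cmeasurable_comp E); apply: cmeasurable_pair.
    exact: (cmeasurable_comp_measurable (@measurable_iter_shiftmap _ G n.+1) mv).
  exact: cmeasurable_coord.
have ae_e : {ae m, forall z : Z, forall n,
    is_lift_edge (v (iter n.+1 sh z)) (v (iter n sh z)) (z n) (e n z)}.
  apply: filterS ae_lift_edge => z zl n; have [l lP] := zl n.
  by rewrite /e (EP _ _ _ _ lP).
have [Psi mPsi PsiE] : exists2 f : Z -> shift_space L, measurable_fun setT f &
    {ae m, forall t n, f t n = e n t}.
  apply: measurable_lift => // n; apply: filterS ae_e => z ez.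
  by have [-> _ _] := ez n; have [_ -> _] := ez n.+1.
have [mL mLE] := pushforward_probability m mPsi.
exists mL, m, (kdirac mPsi); split=> //.
- move=> n l ladm; rewrite mLE.
  pose g k := gamma (l k).
  have [g0 [st _ _ pg]] := graph_homP gamma.
  have gadm : admissible n g.
    by move=> k kn; rewrite /g (st _).1 (st _).2 ladm.
  have mvh : measurable
      (v @^-1` [set src (l n)] `&` @head_vertex _ G @^-1` [set src (g n)]).
    by apply: measurableI; [exact: mv|exact: cmeasurable_head_vertex].
  (* A path in [L] is determined by its image and its initial vertex, the source of [l n]. So the
     cylinder of [l] is almost surely a cylinder of [g] with a condition on [v] at time [n.+1]. *)
  have -> : m (Psi @^-1` cylinder n l) = m (cylinder n g `&` iter n.+1 sh @^-1`
      (v @^-1` [set src (l n)] `&` @head_vertex _ G @^-1` [set src (g n)])).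
    apply: ae_eq_measure.
    - exact: (measurable_preimageT mPsi (measurable_cylinder n l)).
    - apply: measurableI; first exact: measurable_cylinder.
      exact: (measurable_preimageT (@measurable_iter_shiftmap _ G n.+1)).
    apply: filterS2 ae_e PsiE => z ez Pz; split=> [zl|[zg [zv _]] k].
      have zg k : (k <= n)%N -> z k = g k.
        by move=> kn; have [_ _ <-] := ez k; rewrite -Pz zl.
      split=> //; split.
        change (v (iter n.+1 sh z) = src (l n)).
        by have [<- _ _] := ez n; rewrite -Pz zl.
      change (head_vertex (iter n.+1 sh z) = src (g n)).
      by rewrite /head_vertex iter_shiftmapE addn0 -shiftP zg.
    rewrite Pz => kn.
    (* The edges are identified from index [n] downwards, since each one starts where the edge of
       next higher index ends. *)
    have H j : (j <= n)%N -> e (n - j)%N z = l (n - j)%N.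
      elim: j => [_|j IHj jn].
        rewrite subn0; have [en _ gn] := ez n.
        apply: (graph_hom_inj (phi := gamma)); last by rewrite gn zg.
        by rewrite en; exact: zv.
      have [en _ gn] := ez (n - j.+1)%N.
      apply: (graph_hom_inj (phi := gamma)); last first.
        by rewrite gn zg // leq_subr.
      have lt : (n - j.+1 < n)%N by rewrite ltn_subrL /= (leq_trans _ jn).
      have jE : (n - j.+1).+1 = (n - j)%N by rewrite subnSK.
      rewrite en ladm // jE -IHj ?(ltnW jn) //.
      by have [_ <- _] := ez (n - j)%N.
    by rewrite -(subKn kn); apply: H; exact: leq_subr.
  rewrite markov_cylinder //.
  rewrite EFinM; congr (_%:E * _)%E; first by apply: eq_bigr => k _; rewrite /g pg.
  (* Almost surely [head_vertex z] is the image of [v z], so the event is that [v z] is the source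
     of [l n]. *)
  rewrite -m_v; apply: ae_eq_measure => //.
  apply: filterS ae_edge => z [l' [_ tl' gl']]; split=> [[]//|zv]; split=> //.
  rewrite /= /head_vertex -gl' (st _).2 tl' [v z]zv.
  by rewrite -(st _).1.
- move=> A mA; rewrite mLE.
  transitivity (\int[m]_(z in setT) (\1_(Psi @^-1` A) z)%:E)%E.
    by rewrite integral_indic ?setIT //; exact: (measurable_preimageT mPsi mA).
  by apply: eq_integral => z _; rewrite /kdirac /= diracE indicE.
apply: filterS2 ae_e PsiE => z ez Pz; exists (fun=> Psi z); split.
- by move=> i j _; rewrite !ord1.
- move=> _; apply: markov_shift_ext => n /=; rewrite Pz.
  by have [_ _ ->] := ez n.
- by move=> A mA; rewrite big_ord_recl big_ord0 adde0 invr1 mul1e.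
Qed.

(** The set [C] of vertices reachable from [c] is closed under edges, so its preimage under [v] is
    invariant and, by ergodicity over [G], has mass 0 or 1. It contains an event of positive mass,
    so it has mass 1; as every vertex has positive mass, all are reachable. *)
Lemma lift_irreducible : irreducible_graph G -> irreducible_graph L.
Proof.
move=> Girr c c'.
pose C : set (vertex L) := [set u | exists n (l : nat -> L),
  [/\ admissible n l, src (l n) = c & tgt (l 0%N) = u]].
have Ccl l : C (src l) -> C (tgt l).
  move=> [n [l' [adm sc tl]]].
  exists n.+1, (fun k => if k is k'.+1 then l' k' else l); split=> //.
  by case=> [|k] //=; exact: adm.
have mA : measurable (v @^-1` C) by exact: cmeasurable_preimage.
have mass u : m (v @^-1` [set u]) != 0%E.
  by rewrite m_v eqe gt_eqF // prob0_gt0.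
have Ainv : {ae m, forall z, (v @^-1` C) (sh z) -> (v @^-1` C) z}.
  apply: filterS ae_edge => z [l [sl tl _]]; rewrite /preimage /= -sl -tl.
  exact: Ccl.
have [l1 sl1] := src_surj c.
have Cl1 : C (tgt l1) by exists 0%N, (fun=> l1).
have A1 : m (v @^-1` C) = 1%E.
  have [A0|//] := ergodic mM Girr mA Ainv.
  have := mass (tgt l1); rewrite -measure_le0 -A0 => /negP[].
  by apply: le_measure; rewrite ?inE // => z /= ->.
have A0 : {ae m, forall z, (v @^-1` C) z}.
  exists (~` (v @^-1` C)); split=> //; first exact: measurableC.
  by rewrite probability_setC // A1 subee.
have [z zc' zC] := ae_exists (mv c') (mass c') A0.
by move: zC; rewrite /preimage /= zc'.
Qed.

End Lifting.

(** * The graph of fibres and its skew product *)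

Section CodingGraph.
Variables (R : realType) (I : countType) (rho : I -> R).
Variables (rho_gt0 : forall i, 0 < rho i).
Variables (rho_sum : (\esum_(i in [set: I]) (rho i)%:E = 1)%E).
Let K := bernoulli_graph rho_gt0 rho_sum.
Local Notation X := (shift_space K).
Variable mK : probability X R.
Hypothesis mKM : is_markov_measure mK.
Variables (W : countType) (tau : X -> W) (step : I -> W -> W).
Hypothesis mtau : cmeasurable tau.
Hypothesis tau_mass : forall s, mK (tau @^-1` [set s]) != 0%E.
Hypothesis tau_step :
  {ae mK, forall x, tau x = step (x 0%N) (tau (@shiftmap _ K x))}.

Let cedge : countType := (W * I)%type.
Let csrc (e : cedge) : W := e.1.
Let ctgt (e : cedge) : W := step e.2 e.1.
Let cprob (e : cedge) : R := rho e.2.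
Let cprob0 (s : W) : R := fine (mK (tau @^-1` [set s])).

Let cprob0E s : (cprob0 s)%:E = mK (tau @^-1` [set s]).
Proof. by rewrite fineK // fin_num_measure //; exact: mtau. Qed.

Let csrc_surj s : exists e, csrc e = s.
Proof. by have [i _] := src_surj (tt : vertex K); exists (s, i). Qed.

Let ctgt_surj s : exists e, ctgt e = s.
Proof.
have [x xs xst] := ae_exists (mtau s) (tau_mass s) tau_step.
by exists (tau (@shiftmap _ K x), x 0%N); rewrite /ctgt /= -xst.
Qed.

Let cprob_gt0 e : 0 < cprob e. Proof. exact: rho_gt0. Qed.

Let cprob_sum s : (\esum_(e in [set e | csrc e = s]) (cprob e)%:E = 1)%E.
Proof.
rewrite -rho_sum (_ : [set e | _] = (fun i : I => (s, i)) @` setT).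
  by rewrite esum_image // => i j _ _ [].
by apply/seteqP; split=> [[s' i] /= <-|_ [i _ <-] //]; exists i.
Qed.

Let cprob0_gt0 s : 0 < cprob0 s.
Proof. by rewrite -lte_fin cprob0E lt0e tau_mass measure_ge0. Qed.

Let cprob0_sum : (\esum_(s in [set: W]) (cprob0 s)%:E = 1)%E.
Proof.
transitivity (mK (setT `&` tau @^-1` setT)); last first.
  by rewrite setTI preimage_setT probability_setT.
rewrite [RHS](measure_cmeasurable mK _ mtau measurableT).
by apply: eq_esum => s _; rewrite cprob0E setTI.
Qed.

(** The event that [tau x] is [s] is split by the state of the shifted point and the first letter of
    [x]. These are independent, which gives the products in the sum. *)
Let cstationary s :
  (\esum_(e in [set e | ctgt e = s]) (cprob e * cprob0 (csrc e))%:E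
    = (cprob0 s)%:E)%E.
Proof.
pose e0 (x : X) : cedge := (tau (@shiftmap _ K x), x 0%N).
have me0 : cmeasurable e0.
  apply: cmeasurable_pair; last exact: cmeasurable_coord.
  exact: (cmeasurable_comp_measurable (@measurable_shiftmap _ K) mtau).
transitivity (mK (setT `&` e0 @^-1` [set e | ctgt e = s])).
  rewrite [RHS](measure_cmeasurable mK _ me0 measurableT).
  apply: eq_esum => -[s' i] _; rewrite setTI EFinM cprob0E.
  rewrite -(bernoulli_independent mKM i (mtau s')); congr (mK _).
  by apply/seteqP; split=> x /=; [move=> [xi xs]; rewrite /e0 xi; congr (_, _)|move=> [<- <-]].
rewrite cprob0E setTI; apply: ae_eq_measure => //.
  exact: cmeasurable_preimage.
by apply: filterS tau_step => x xs; rewrite /preimage /= [in X in _ <-> X]xs.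
Qed.

Definition coding_graph : stochGraph R :=
  StochGraph csrc_surj ctgt_surj cprob_gt0 cprob_sum cprob0_gt0 cprob0_sum
    cstationary.

Lemma coding_label_subproof : @is_graph_hom R coding_graph K snd.
Proof.
have [s0 _] : exists s : W, True by exists (tau point).
exists (fun=> tt); split=> // [[]|s]; first by exists s0.
split=> // [[s1 i] [s2 j] /=|i _]; last by exists (s, i).
by rewrite !inE /= => -> -> ->.
Qed.

Definition coding_label : graph_hom coding_graph K :=
  GraphHom coding_label_subproof.

(** The state is a function of the label sequence, so the lifting criterion applies with [tau] as
    the choice of vertex. *)
Lemma coding_label_degree1 : has_degree coding_label 1.
Proof.
apply: (@lift_has_degree1 _ K coding_graph coding_label mK mKM tau mtau) => [s|].
  exact/esym/cprob0E.
apply: filterS tau_step => x xs.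
by exists (tau (@shiftmap _ K x), x 0%N); split=> //; rewrite [RHS]xs.
Qed.

End CodingGraph.

(** * The homomorphism from the skew product to the original graph *)

Section SkewLift.
Variables (R : realType) (I : countType) (rho : I -> R).
Variables (rho_gt0 : forall i, 0 < rho i).
Variables (rho_sum : (\esum_(i in [set: I]) (rho i)%:E = 1)%E).
Let K := bernoulli_graph rho_gt0 rho_sum.
Variables (G : stochGraph R) (phi : graph_hom G K) (d : nat).
Hypothesis G_irr : irreducible_graph G.
Hypothesis d_gt0 : (0 < d)%N.
Local Notation X := (shift_space K).
Local Notation Z := (shift_space G).
Local Notation V := (vertex G).
Variables (mG : probability Z R) (mK : probability X R).
Variables (kappa : R.-pker X ~> Z).
Hypothesis mGM : is_markov_measure mG.
Hypothesis mKM : is_markov_measure mK.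
Hypothesis mG_kappa :
  forall A, measurable A -> mG A = (\int[mK]_x kappa x A)%E.
Hypothesis ae_fibre : {ae mK, forall x, exists y, is_fibre (d := d) phi kappa x y}.
Variable e : V -> I -> G.
Hypothesis eP : forall u i, src (e u i) = u /\ phi (e u i) = i.
Variables (W : countType) (tau : X -> W) (w : W -> d.-tuple V).
Variables (step : I -> W -> W) (a : I -> W -> {perm 'I_d}).
Hypothesis mtau : cmeasurable tau.
Hypothesis tau_mass : forall s, mK (tau @^-1` [set s]) != 0%E.
Hypothesis tau_step :
  {ae mK, forall x, tau x = step (x 0%N) (tau (@shiftmap _ K x))}.
Hypothesis w_uniq : forall s, uniq (w s).
Hypothesis w_step : forall i s y,
  tnth (w (step i s)) (a i s y) = tgt (e (tnth (w s) y) i).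
Hypothesis kappa_w : {ae mK, forall x, forall u,
  kappa x (vertex_at 0 u) = ((u \in w (tau x))%:R / d%:R)%:E}.

Let H := coding_graph mKM mtau tau_mass tau_step.
Let Phi := factor_map phi.
Let hv := @head_vertex _ G.
Let sh := @shiftmap _ G.

Definition coding_perm (l : H) : {perm 'I_d} := a l.2 l.1.

Let Hbar := skew_graph d_gt0 coding_perm.

Definition skew_edge (l : Hbar) : G := e (tnth (w l.1.1) l.2) l.1.2.

Let label_edge (g : G) : e (src g) (phi g) = g.
Proof.
have [sg pg] := eP (src g) (phi g).
exact: (graph_hom_inj (phi := phi)).
Qed.

Let w_inj s : injective (tnth (w s)).
Proof. exact/tuple_uniqP. Qed.

Lemma skew_edge_subproof : is_graph_hom skew_edge.
Proof.
pose phi0 (p : vertex Hbar) := tnth (w p.1) p.2.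
exists phi0; split.
- move=> [[s i] y]; split; first by have [] := eP (tnth (w s) y) i.
  by rewrite /phi0 /= /coding_perm /= -w_step.
- move=> u; have [s0 _] : exists s : W, True by exists (tau point).
  (* Surjectivity on vertices: the image is nonempty and, by [w_step], closed under edges, so
     irreducibility of [G] makes it everything. *)
  apply: (@irreducible_closed _ G [set u | exists p, phi0 p = u]
    (phi0 (s0, Ordinal d_gt0))) => // [g [[s y] sy]|]; last first.
    by exists (s0, Ordinal d_gt0).
  exists (step (phi g) s, a (phi g) s y).
  by rewrite /phi0 /= w_step -[tnth _ _]/(phi0 (s, y)) sy label_edge.
- move=> [s y]; split.
  + by move=> [[s' i] y'] /= [<- <-]; have [] := eP (tnth (w s') y') i.
  + move=> [[s1 i1] y1] [[s2 i2] y2]; rewrite !inE /=.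
    move=> [-> ->] [-> ->] /(congr1 phi).
    rewrite /skew_edge /=.
    have [_ ->] := eP (tnth (w s) y) i1; have [_ ->] := eP (tnth (w s) y) i2.
    by move=> ->.
  + move=> g /= gs; exists ((s, phi g : I), y) => //.
    by rewrite /skew_edge /= -[tnth _ _]/(phi0 (s, y)) -gs label_edge.
- move=> [[s i] y]; rewrite (prob_label phi) /skew_edge /=.
  by have [_ ->] := eP (tnth (w s) y) i.
Qed.

Definition skew_lift : graph_hom Hbar G := GraphHom skew_edge_subproof.

Lemma skew_lift_label (l : Hbar) :
  phi (skew_lift l) = coding_label mKM mtau tau_mass tau_step (skew_proj d_gt0 coding_perm l).
Proof. by have [] := eP (tnth (w l.1.1) l.2) l.1.2. Qed.

(** Inverse of the map that sends a position [y] in the list of [s] to the vertex found there; for a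
    vertex outside the list the first position is an arbitrary default. *)
Let vertex_code (p : W * V) : vertex Hbar :=
  (p.1, xget (Ordinal d_gt0) [set y | tnth (w p.1) y = p.2]).

Let v (z : Z) : vertex Hbar := vertex_code (tau (Phi z), hv z).

Let mtauPhi : cmeasurable (tau \o Phi).
Proof. exact: (cmeasurable_comp_measurable (measurable_factor_map phi) mtau). Qed.

Let mpair : cmeasurable (fun z : Z => (tau (Phi z), hv z)).
Proof. exact: (cmeasurable_pair mtauPhi (@cmeasurable_head_vertex _ G)). Qed.

Let mv : cmeasurable v. Proof. exact: (cmeasurable_comp vertex_code mpair). Qed.

Let vertex_codeE s u y : tnth (w s) y = u -> vertex_code (s, u) = (s, y).
Proof.
move=> yu; congr (_, _); apply: (@w_inj s).
rewrite [RHS]yu.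
exact: (@xgetPex _ (Ordinal d_gt0) [set y | tnth (w s) y = u]
  (ex_intro _ y yu)).
Qed.

(** Over the state [s] the kernel gives the vertex [u] the constant mass 1/d or 0, so the integral
    in [disintegration] is that constant times the mass of the state. *)
Let mass_pair s u : mG [set z | (tau (Phi z), hv z) = (s, u)] =
  (((u \in w s)%:R / d%:R)%:E * mK (tau @^-1` [set s]))%E.
Proof.
rewrite (_ : [set z | _] = vertex_at 0 u `&` Phi @^-1` (tau @^-1` [set s])).
  rewrite (disintegration mG_kappa ae_fibre (measurable_vertex_at 0 u) (mtau s)).
  transitivity (\int[mK]_(x in tau @^-1` [set s]) cst ((u \in w s)%:R / d%:R)%:E x)%E.
    apply: ge0_ae_eq_integral => //.
    - apply: measurable_funTS.
      exact: (measurable_kernel kappa _ (measurable_vertex_at 0 u)).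
    - by move=> x _; rewrite lee_fin divr_ge0.
    - by apply: filterS kappa_w => x kx /= xs; rewrite kx xs.
  by rewrite integral_cst.
by apply/seteqP; split=> z /= => [[]|[<- <-]].
Qed.

Let ae_hv : {ae mG, forall z, hv z \in w (tau (Phi z))}.
Proof.
exists ((fun z : Z => (tau (Phi z), hv z)) @^-1` [set p | p.2 \notin w p.1]).
split.
- exact: cmeasurable_preimage.
- rewrite -[_ @^-1` _]setTI measure_cmeasurable // esum1 // => -[s u] /= us.
  by rewrite setTI mass_pair (negbTE us) mul0r mul0e.
- by move=> z /negP.
Qed.

Let ae_v : {ae mG, forall z, tnth (w (v z).1) (v z).2 = hv z /\ (v z).1 = tau (Phi z)}.
Proof.
apply: filterS ae_hv => z /tnthP[y yE].
by rewrite /v (vertex_codeE (esym yE)) yE.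
Qed.

Lemma skew_lift_mass u : mG (v @^-1` [set u]) = (prob0 u)%:E.
Proof.
case: u => s y.
transitivity (mG [set z | (tau (Phi z), hv z) = (s, tnth (w s) y)]).
  apply: ae_eq_measure => //; first exact: (mpair (s, tnth (w s) y)).
  apply: filterS ae_v => z [zv zs]; split=> [vz|[zs' zy]].
    by move: zv zs; rewrite [v z]vz /= => <- <-.
  by rewrite /preimage /= /v zs' zy (vertex_codeE erefl).
rewrite mass_pair mem_tnth mul1r muleC.
by rewrite /prob0 /= EFinM fineK // fin_num_measure //; exact: (mtau s).
Qed.

Lemma skew_lift_edge : {ae mG, forall z : Z,
  exists l, is_lift_edge skew_lift (v (sh z)) (v z) (z 0%N) l}.
Proof.
have vsh := ae_iter_shift mGM 1 ae_v.
have ts := ae_factor mG_kappa ae_fibre tau_step.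
apply: filterS3 ae_v vsh ts => z [zv zs] [zv' zs'] zt.
(* The lifted edge starts at [v (sh z)] and carries the label of the first edge of [z]. Its end is
   [v z] by [w_step], because the entries of each list are distinct. *)
exists (((v (sh z)).1, phi (z 0%N) : I), (v (sh z)).2).
have E : e (hv (sh z)) (phi (z 0%N)) = z 0%N.
  by rewrite -[RHS]label_edge /hv /head_vertex shiftP.
split.
- exact/esym/surjective_pairing.
- have s1 : (v z).1 = step (phi (z 0%N)) (v (sh z)).1.
    by rewrite zs zt zs' /Phi factor_map_shift.
  rewrite [RHS]surjective_pairing; congr (_, _); first exact: esym s1.
  by apply: (@w_inj (v z).1); rewrite zv s1 [LHS]w_step zv' E.
- by rewrite /= /skew_edge /= zv' E.
Qed.

Lemma skew_lift_degree1 : has_degree skew_lift 1.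
Proof. exact: (lift_has_degree1 mGM mv skew_lift_mass skew_lift_edge). Qed.

Lemma skew_graph_irreducible : irreducible_graph Hbar.
Proof. exact: (lift_irreducible mGM mv skew_lift_mass skew_lift_edge). Qed.

End SkewLift.

(** * Assembly of the commutative diagram *)

Theorem theorem3p24 (R : realType) (I : countType) (rho : I -> R)
    (rho_gt0 : forall i, 0 < rho i)
    (rho_sum : (\esum_(i in [set: I]) (rho i)%:E = 1)%E)
    (G : stochGraph R) (G_uniform : rho_uniform rho_gt0 rho_sum G)
    (G_irr : irreducible_graph G)
    (phi : graph_hom G (bernoulli_graph rho_gt0 rho_sum))
    (d : nat) (d_gt0 : (0 < d)%N) (phi_deg : has_degree phi d) :
  exists (H : stochGraph R) (a : H -> {perm 'I_d})
         (psibar : graph_hom (skew_graph d_gt0 a) G)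
         (psi : graph_hom H (bernoulli_graph rho_gt0 rho_sum)),
    [/\ forall e : skew_graph d_gt0 a,
          phi (psibar e) = psi (skew_proj d_gt0 a e),
        has_degree psibar 1,
        has_degree psi 1 &
        Ext d_gt0 (skew_proj d_gt0 a) psi].
Proof.
have [mG [mK [kappa [mGM mKM mG_kappa ae_fibre]]]] := phi_deg.
have [e eP] := labelled_edge phi.
have [u0 _] : exists u : vertex G, True.
  by have [x _] := shift_inhabited G; exists (tgt (x 0%N)).
have fE (g : G) : tgt g = tgt (e (src g) (phi g)).
  have [sg pg] := eP (src g) (phi g).
  by congr tgt; apply: (graph_hom_inj (phi := phi)).
have [W [tau [w [step [a [mtau mass tstep [wU wstep kw]]]]]]] :=
  fibre_coding mGM mKM mG_kappa ae_fibre d_gt0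
    (f := fun i u => tgt (e u i)) fE u0.
exists (coding_graph mKM mtau mass tstep), (coding_perm a (tau_step := tstep)).
exists (skew_lift G_irr d_gt0 mKM eP mtau mass tstep wstep).
exists (coding_label mKM mtau mass tstep).
have deg_psi := coding_label_degree1 mKM mtau mass tstep.
split=> //.
- exact: skew_lift_label.
- exact: (skew_lift_degree1 G_irr d_gt0 mGM mKM mG_kappa ae_fibre eP mtau
    mass tstep wU wstep kw).
- apply: Ext_intro => //.
  exact: (skew_graph_irreducible G_irr mGM mG_kappa ae_fibre eP wU wstep kw).
Qed.
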